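(* Let $(H,X,V,\mathcal L,A,B,P,Q)$ be an admissible tuple (defined in the context), suppose $\theta$ is an isolated critical point of $\mathcal L$, and let $\mathbf K$ be an abelian group. The following are equivalent: (i) $\theta$ is a local minimum of $\mathcal L$; (ii) $C_q(\mathcal L,\theta;\mathbf K)\cong\delta_{q0}\mathbf K$ for all $q\in\mathbb Z$; (iii) $C_0(\mathcal L,\theta;\mathbf K)\ne0$.
   Context: Conventions. All vector spaces are real; $\theta$ denotes the origin of any of them. $L_s(H)\subset L(H)$ is the space of bounded self-adjoint operators. A map $T:U\to E_2$ on an open subset $U$ of a normed space $E_1$ is continuously directional differentiable on $U$ if $DT(x,u)=\lim_{t\to0}(T(x+tu)-T(x))/t$ exists for all $x\in U$, $u\in E_1$ and $(x,u)\mapsto DT(x,u)$ is continuous on $U\times E_1$ (then $DT(x):=DT(x,\cdot)$ is bounded linear). $T$ is strictly Fréchet differentiable at $x_0$ if there is $T'(x_0)\in L(E_1,E_2)$ with $\|T(x)-T(y)-T'(x_0)(x-y)\|=o(\|x-y\|)$ as $x\to x_0$, $y\to x_0$. A critical point is a point where the (Gâteaux) derivative vanishes. Admissible tuple. $(H,X,V,\mathcal L,A,B,P,Q)$ is admissible if: (S) $H$ is a Hilbert space with inner product $(\cdot,\cdot)_H$ and norm $\|\cdot\|$; $X$ is a Banach space with norm $\|\cdot\|_X$; $X\subset H$ is a dense linear subspace and $\|x\|\le\|x\|_X$ for $x\in X$. $V$ is an open neighborhood of $\theta$ in $H$; $V^X:=V\cap X$ regarded as an open subset of $X$. (F1) $\mathcal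 L:V\to\mathbb R$ is continuously directional differentiable on $V$. (F2) $A:V^X\to X$ is continuously directional differentiable, strictly Fréchet differentiable at $\theta$, and $D\mathcal L(x)(u)=(A(x),u)_H$ for all $x\in V^X$, $u\in X$. (F3) $B:V^X\to L_s(H)$ is a map with $(DA(x)(u),v)_H=(B(x)u,v)_H$ for all $x\in V^X$, $u,v\in X$. (C1) $\theta$ is a critical point of $\mathcal L|_{V^X}$ (and thus of $\mathcal L$), and $0$ is either not in the spectrum $\sigma(B(\theta))$ or is an isolated point of it. (C2) If $u\in H$ and $B(\theta)u\in X$, then $u\in X$. (D) $B(x)=P(x)+Q(x)$ for all $x\in V^X$, where $P(x):H\to H$ is a positive definite linear operator and $Q(x):H\to H$ is a compact linear operator, with: (D1) all eigenvectors of $B(\theta)$ belonging to negative eigenvalues lie in $X$; (D2) for any sequence $\{x_k\}\subset V\cap X$ with $\|x_k\|\to0$, $\|P(x_k)u-P(\theta)u\|\to0$ for every $u\in H$; (D3) $Q:V\cap X\to L(H)$ is continuous at $\theta$ with respect to the topology on $V\cap X$ induced from $H$; (D4) for any sequence $\{x_n\}\subset V\cap X$ with $\|x_n\|\to0$ there exist $C_0>0$ and $n_0\in\mathbb N$ with $(P(x_n)u,u)_H\ge C_0\|u\|^2$ for all $u\in H$, $n\ge n_0$. Critical groups. For a continuous real function $f$ on a metric space $M$ and $x\in M$ with $f(x)=c$, $C_q(f,x;\mathbf K)=H_q(f_c\cap U,f_c\cap U\setminus\{x\};\mathbf K)$ (relative singular homology), where $f_c=\{f\le c\}$ and $U$ is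 any neighborhood of $x$; $C_q=0$ for $q<0$. $\delta_{q0}\mathbf K$ is $\mathbf K$ if $q=0$ and $0$ otherwise.
   Formalization: The abelian group K is assumed nonzero; for K = 0 condition (ii) always holds and (iii) never does, so the stated equivalence fails. *)

(* Defs.v *)
From HB Require Import structures.
From mathcomp Require Import all_boot all_order all_algebra finmap.
From mathcomp Require Import all_classical all_reals all_analysis.
(* The notations of monalg clash with those of the analysis library. *)
From mathcomp Require Import -(notations) monalg.

Set Implicit Arguments.
Unset Strict Implicit.
Unset Printing Implicit Defensive.

Import Order.TTheory GRing.Theory Num.Theory.
Import numFieldNormedType.Exports.

Local Open Scope classical_set_scope.
Local Open Scope ring_scope.

Definition isomorphic (G G' : zmodType) : Prop :=
  exists f : {additive G -> G'}, bijective f.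

Definition nontrivial (G : zmodType) : Prop := exists g : G, g != 0.

Definition trivial_group : zmodType := 'rV[int]_0.

Definition delta_group (q : int) (G : zmodType) : zmodType :=
  if q == 0 then G else trivial_group.

Section StandardSimplex.
Variable R : realType.

Definition std_simplex (n : nat) : set 'rV[R]_n.+1 :=
  [set t | (forall i, 0 <= t 0 i) /\ \sum_i t 0 i = 1].
Arguments std_simplex : clear implicits.

Definition coface_row (n : nat) (i : 'I_n.+2) (t : 'rV[R]_n.+1) : 'rV[R]_n.+2 :=
  \row_(j < n.+2) oapp (fun k => t 0 k) 0 (unlift i j).

Lemma coface_row_subproof (n : nat) (i : 'I_n.+2) (t : std_simplex n) :
  coface_row i (set_val t) \in std_simplex n.+1.
Proof.
have [t0 t1] : std_simplex n (set_val t) := set_valP t.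
apply/mem_set; split=> [j|].
  by rewrite mxE; case: unliftP => [k|] _ /=.
rewrite (bigD1_ord i) //= mxE unlift_none add0r -[RHS]t1.
by apply: eq_bigr => k _; rewrite mxE liftK.
Qed.

Definition coface (n : nat) (i : 'I_n.+2) (t : std_simplex n) :
  std_simplex n.+1 :=
  exist (fun x => x \in std_simplex n.+1) _ (coface_row_subproof i t).

Lemma coface_row_continuous (n : nat) (i : 'I_n.+2) :
  continuous (coface_row (n := n) i).
Proof.
move=> t D [F Ft FD]; exists (fun a k => F a (lift i k)).
  by move=> a k; have := Ft a (lift i k); rewrite (ord1 a) mxE liftK.
move=> s sF; apply: FD => a j; rewrite mxE (ord1 a).
case: unliftP => [k ->|->] /=; first exact: sF.
by have := Ft 0 i; rewrite mxE unlift_none => /nbhs_singleton.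
Qed.

Lemma coface_continuous (n : nat) (i : 'I_n.+2) :
  continuous (coface (n := n) i).
Proof.
apply: continuous_comp_initial => t.
apply: (@continuous_comp _ _ _ set_val (coface_row i)).
  exact: initial_continuous.
exact: coface_row_continuous.
Qed.

HB.instance Definition _ (n : nat) (i : 'I_n.+2) :=
  @isContinuous.Build _ _ (coface (n := n) i) (@coface_continuous n i).

End StandardSimplex.
Arguments std_simplex : clear implicits.

Section SingularChains.
Variables (R : realType) (T : topologicalType) (K : zmodType).

Definition singular_simplex (n : nat) : choiceType :=
  continuousType (std_simplex R n) T.

Definition face (n : nat) (i : 'I_n.+2) (s : singular_simplex n.+1) :
  singular_simplex n := s \o coface i.

Definition chain (n : nat) : zmodType := malg (singular_simplex n) K.

Definition boundary_succ (n : nat) (c : chain n.+1) : chain n :=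
  \sum_(s <- msupp c) \sum_(i < n.+2)
    mkmalgU (face i s) (mcoeff s c) *~ (-1) ^+ i.

Definition boundary (n : nat) : chain n -> chain n.-1 :=
  match n with 0 => fun=> 0 | m.+1 => @boundary_succ m end.

Lemma boundary_is_additive (n : nat) : {morph @boundary n : c d / c - d}.
Proof.
case: n => [c d|n c d /=]; first by rewrite subrr.
pose D := (msupp c `|` msupp d)%fset.
have ext b : (msupp b `<=` D)%fset -> boundary_succ b =
    \sum_(s <- D) \sum_(i < n.+2) mkmalgU (face i s) (mcoeff s b) *~ (-1) ^+ i.
  move=> bD; rewrite /boundary_succ; apply: big_fset_incl => // s _ sb.
  by rewrite (mcoeff_outdom sb); apply: big1 => i _; rewrite monalgU0 mul0rz.
rewrite (ext (c - d)) ?msuppB_le// (ext c) ?fsubsetUl// (ext d) ?fsubsetUr//.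
rewrite -sumrB; apply: eq_bigr => s _; rewrite -sumrB; apply: eq_bigr => i _.
by rewrite mcoeffB monalgUB mulrzBl.
Qed.

HB.instance Definition _ n :=
  GRing.isZmodMorphism.Build (chain n) (chain n.-1) (@boundary n)
    (@boundary_is_additive n).

Definition chain_in (n : nat) (S : set T) (c : chain n) : Prop :=
  forall s, s \in msupp c -> range (s : std_simplex R n -> T) `<=` S.

Lemma chain_in0 n (S : set T) : chain_in (n := n) S 0.
Proof. by move=> s; rewrite msupp0. Qed.

Lemma chain_inB n (S : set T) (c d : chain n) :
  chain_in S c -> chain_in S d -> chain_in S (c - d).
Proof.
move=> cS dS s /(fsubsetP (msuppB_le _ _)).
by rewrite in_fsetU => /orP[/cS|/dS].
Qed.

(* Homology of the pair [(Y, Z)], for subsets [Z `<=` Y] of [T]; simplices of a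
   subset are the simplices of [T] with image in it, and relative cycles are
   represented by chains of [Y] with boundary in [Z]. *)
Section RelativeHomology.
Variables (Y Z : set T) (n : nat).

Definition rel_cycle : {pred chain n} :=
  fun c => `[< chain_in Y c /\ chain_in Z (boundary c) >].

Lemma rel_cycle_zmod_closed : zmod_closed rel_cycle.
Proof.
split.
  by apply/asboolP; split; rewrite ?raddf0; exact: chain_in0.
move=> c d /asboolP[c1 c2] /asboolP[d1 d2]; apply/asboolP.
by split; rewrite ?raddfB; exact: chain_inB.
Qed.

HB.instance Definition _ := GRing.isZmodClosed.Build _ rel_cycle
  rel_cycle_zmod_closed.

Record rel_cycles : predArgType :=
  RelCycle { cycle_val :> chain n; cycle_valP : cycle_val \in rel_cycle }.

HB.instance Definition _ := [isSub for cycle_val].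
HB.instance Definition _ := [Choice of rel_cycles by <:].
HB.instance Definition _ := [SubChoice_isSubZmodule of rel_cycles by <:].

Definition rel_boundary : {pred rel_cycles} :=
  fun c => `[< exists (d : chain n.+1) (e : chain n),
    [/\ chain_in Y d, chain_in Z e & cycle_val c = boundary d + e] >].

Lemma rel_boundary_zmod_closed : zmod_closed rel_boundary.
Proof.
split.
  apply/asboolP; exists 0, 0; split; rewrite ?raddf0 ?addr0 //; exact: chain_in0.
move=> c c' /asboolP[d [e [dY eZ cE]]] /asboolP[d' [e' [dY' eZ' cE']]].
apply/asboolP; exists (d - d'), (e - e'); split; [exact: chain_inB..|].
have -> : cycle_val (c - c') = cycle_val c - cycle_val c' by [].
by rewrite cE cE' (boundary_is_additive (n := n.+1)) opprD addrACA.
Qed.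

HB.instance Definition _ := GRing.isZmodClosed.Build _ rel_boundary
  rel_boundary_zmod_closed.

Definition rel_homology : zmodType := Quotient.quot rel_boundary.

End RelativeHomology.
End SingularChains.

(* [U] stands for the neighborhood of [x] used in the definition; the values
   of [f] outside [U] are irrelevant. *)
Definition critical_group (R : realType) (K : zmodType) (T : topologicalType)
    (f : T -> R) (U : set T) (x : T) (q : int) : zmodType :=
  let S := [set y | f y <= f x] `&` U in
  match q with
  | Posz n => rel_homology R K S (S `\ x) n
  | Negz _ => trivial_group
  end.

(* Functions on an open set [U] are represented by total functions, whose
   values outside [U] do not matter. *)

Definition cont_dir_differentiable (R : realType) (E1 E2 : normedModType R)
    (U : set E1) (T : E1 -> E2) : Prop :=
  (forall x u, U x -> derivable T x u) /\
  {within U `*` [set: E1], continuous (fun p : E1 * E1 => 'D_(p.2) T p.1)}.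

Definition strictly_differentiable (R : realType) (E1 E2 : normedModType R)
    (T : E1 -> E2) (x0 : E1) : Prop :=
  exists T' : {linear E1 -> E2}, continuous T' /\
    forall e : R, 0 < e -> \forall p \near (x0, x0),
      `|T p.1 - T p.2 - T' (p.1 - p.2)| <= e * `|p.1 - p.2|.

Definition critical_point (R : realType) (E : normedModType R) (f : E -> R)
    (x : E) : Prop :=
  forall u, derivable f x u /\ 'D_u f x = 0.

(* Real spectrum; for a self-adjoint operator it is the whole spectrum of the
   complexification. *)
Definition spectrum (R : realType) (E : normedModType R) (T : E -> E) : set R :=
  [set l | ~ exists S : {linear E -> E}, [/\ continuous S,
     forall u, S (T u - l *: u) = u & forall u, T (S u) - l *: S u = u]].

Definition compact_operator (R : realType) (E : normedModType R)
    (T : E -> E) : Prop :=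
  forall D : set E, bounded_set D -> precompact (T @` D).

Definition self_adjoint (R : realType) (E : lmodType R) (ip : E -> E -> R)
    (T : E -> E) : Prop :=
  forall u v, ip (T u) v = ip u (T v).

(* Symmetry of [T] is not part of the definition. *)
Definition positive_definite (R : realType) (E : lmodType R)
    (ip : E -> E -> R) (T : E -> E) : Prop :=
  forall u, u != 0 -> 0 < ip (T u) u.

(* [j] is the inclusion of [X] into [H], so that [V^X] is [j @^-1` V].  The
   maps [A], [B], [P], [Q] are only constrained on [j @^-1` V], and [L] on
   [V].  Bounded linear operators are the continuous linear ones. *)
Record admissible (R : realType) (H : completeNormedModType R)
    (ip : {dot H for idfun}) (X : completeNormedModType R)
    (j : {linear X -> H}) (V : set H) (L : H -> R) (A : X -> X)
    (B P Q : X -> {linear H -> H}) : Prop := Admissible {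
  adm_ip_norm : forall u : H, `|u| ^+ 2 = ip u u;
  adm_j_inj : injective j;
  adm_j_dense : dense (range j);
  adm_j_norm : forall x, `|j x| <= `|x|;
  adm_V_open : open V;
  adm_V0 : V 0;

  adm_F1 : cont_dir_differentiable V L;
  adm_F2_cdd : cont_dir_differentiable (j @^-1` V) A;
  adm_F2_strict : strictly_differentiable A 0;
  adm_F2_grad : forall x u, V (j x) -> 'D_(j u) L (j x) = ip (j (A x)) (j u);
  adm_F3_bounded : forall x, V (j x) -> continuous (B x);
  adm_F3_self_adjoint : forall x, V (j x) -> self_adjoint ip (B x);
  adm_F3_hess : forall x u v, V (j x) ->
    ip (j ('D_u A x)) (j v) = ip (B x (j u)) (j v);

  adm_C1_crit : critical_point (L \o j) 0;
  adm_C1_spectrum : ~ spectrum (B 0) 0 \/ isolated (spectrum (B 0)) 0;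
  adm_C2 : forall u, range j (B 0 u) -> range j u;

  adm_D_decomp : forall x, V (j x) -> forall u, B x u = P x u + Q x u;
  adm_D_pos : forall x, V (j x) -> positive_definite ip (P x);
  adm_D_compact : forall x, V (j x) -> compact_operator (Q x);
  adm_D1 : forall (l : R) (u : H), l < 0 -> u != 0 -> B 0 u = l *: u ->
    range j u;
  adm_D2 : forall x_ : nat -> X, (forall k, V (j (x_ k))) ->
    `|j (x_ k)| @[k --> \oo] --> 0 ->
    forall u, `|P (x_ k) u - P 0 u| @[k --> \oo] --> 0;
  (* a bound [e * `|u|] for all [u] means that the operator norm of
     [Q x - Q 0] is at most [e] *)
  adm_D3 : forall e : R, 0 < e -> exists2 d : R, 0 < d &
    forall x, V (j x) -> `|j x| < d ->
    forall u, `|Q x u - Q 0 u| <= e * `|u|;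
  adm_D4 : forall x_ : nat -> X, (forall k, V (j (x_ k))) ->
    `|j (x_ k)| @[k --> \oo] --> 0 ->
    exists2 C0 : R, 0 < C0 & exists n0 : nat, forall n u, (n0 <= n)%N ->
      C0 * `|u| ^+ 2 <= ip (P (x_ n) u) u
}.

(* Main.v *)
(* Let [S] be the sublevel set of [L] at the critical value, near [0].  The zeroth
   critical group vanishes as soon as some path in [S] leaves [0].  If [0] is a
   local minimum, its isolation as a critical point makes it an isolated point
   of [S], so that the critical groups are the homology groups of a point.

   Otherwise such a path is built directly, without the splitting lemma.  By (D)
   the second derivative on [X] of [L] near [0] is bounded below by
   [c |h|^2 - K |Q(0) h|^2] with [c > 0], and this passes to [H] by density as a
   convexity estimate whose defect [|Q(0) h|^2] is small along ultrafilters,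
   [Q(0)] being compact.  Hence: (1) bounded points at a negative level which are
   close for [|Q(0) h|] are joined by a segment below that level; (2) every point
   of [{L < L 0}] close to [0] is joined, inside a given small ball, to a point
   at a level below a uniform negative one, for otherwise minimizing a penalized
   [L] on the path components of such points would yield almost critical points
   converging to a nonzero critical point.  So, for an ultrafilter converging to
   [0] in [{L < L 0}], almost all points are joined in each small ball, and
   infinitely many of these paths can be concatenated into one starting at [0]. *)
From HB Require Import structures.
Require Import Defs.
From mathcomp Require Import all_boot all_order all_algebra finmap.
From mathcomp Require Import all_classical all_reals all_analysis.
From mathcomp Require Import ring lra.
From mathcomp Require Import -(notations) monalg.

Set Implicit Arguments.
Unset Strict Implicit.
Unset Printing Implicit Defensive.

Import Order.TTheory GRing.Theory Num.Theory.
Import numFieldNormedType.Exports.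

Local Open Scope classical_set_scope.
Local Open Scope ring_scope.

(** * Paths *)

(** Paths live on the whole line and are constant outside [[0, 1]], so that affine
    reparametrizations and sums of paths stay globally continuous. *)
Definition joined (R : realType) (H : normedModType R) (W : set H) (x y : H) :=
  exists p : R -> H, [/\ continuous p, (forall t, t <= 0 -> p t = x),
    (forall t, 1 <= t -> p t = y) & forall t, W (p t)].

Section Joined.
Variables (R : realType) (H : normedModType R).
Implicit Types (W : set H) (x y z : H).

Lemma continuous_affine_comp (p : R -> H) (a b : R) :
  continuous p -> continuous (fun t : R => p (a * t + b)).
Proof.
move=> cp t; apply: (@continuous_comp _ _ _ (fun t : R => a * t + b) p).
  by apply: cvgD; [exact: mulrl_continuous|exact: cvg_cst].
exact: cp.
Qed.

Lemma joined_mem W x y : joined W x y -> W x /\ W y.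
Proof.
move=> [p [_ p0 p1 pW]]; split; [rewrite -(p0 0)//|rewrite -(p1 1)//]; exact: pW.
Qed.

Lemma joined_refl W x : W x -> joined W x x.
Proof. by move=> Wx; exists (fun=> x); split=> // t; exact: cvg_cst. Qed.

Lemma joined_sym W x y : joined W x y -> joined W y x.
Proof.
move=> [p [cp p0 p1 pW]]; exists (fun t => p (-1 * t + 1)); split.
- exact: continuous_affine_comp.
- by move=> t t0; apply: p1; lra.
- by move=> t t0; apply: p0; lra.
- by move=> t; exact: pW.
Qed.

(* Both paths being constant outside [[0, 1]], the concatenation is given by a
   single formula, whose continuity needs no gluing. *)
Lemma joined_trans W x y z : joined W x y -> joined W y z -> joined W x z.
Proof.
move=> [p [cp p0 p1 pW]] [q [cq q0 q1 qW]].
exists (fun t => p (2 * t + 0) + q (2 * t - 1) - y); split.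
- move=> t; apply: cvgB; last exact: cvg_cst.
  by apply: cvgD; exact: continuous_affine_comp.
- by move=> t t0; rewrite p0 ?q0 ?addrK//; lra.
- by move=> t t0; rewrite p1 ?q1 1?addrC ?addKr//; lra.
- move=> t; have [t2|t2] := leP (2 * t) 1.
    by rewrite (q0 (2 * t - 1)) ?addrK//; lra.
  by rewrite p1 1?addrC ?addKr//; lra.
Qed.

Lemma joined_segment W x h :
  (forall t : R, 0 <= t <= 1 -> W (x + t *: h)) -> joined W x (x + h).
Proof.
move=> xW; exists (fun t => x + Num.min 1 (Num.max 0 t) *: h); split.
- move=> t; apply: cvgD; first exact: cvg_cst.
  apply: cvgZr_tmp.
  apply: continuous_min; first exact: cvg_cst.
  by apply: continuous_max; [exact: cvg_cst|exact: cvg_id].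
- by move=> t t0; rewrite (max_idPl t0) (min_idPr ler01) scale0r addr0.
- move=> t t1; rewrite (@max_r _ _ 0) ?(le_trans ler01)// (min_idPl t1).
  by rewrite scale1r.
- by move=> t; apply: xW; rewrite le_min ler01 le_max lexx ge_min lexx.
Qed.

Lemma joined_subset W W' x y : W `<=` W' -> joined W x y -> joined W' x y.
Proof.
by move=> WW' [p [cp p0 p1 pW]]; exists p; split=> // t; apply/WW'/pW.
Qed.

(* The path runs through [x_ n.+1] and [x_ n] at the times [2^-(n+1)] and
   [2^-n]. *)
Lemma joined_limit (W : nat -> set H) (S : set H) (x_ : nat -> H) :
  (forall n, W n.+1 `<=` W n) -> W 0%N `<=` S -> S 0 ->
  (forall e : R, 0 < e -> exists n, forall y, W n y -> `|y| < e) ->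
  (forall n, joined (W n) (x_ n.+1) (x_ n)) -> joined S 0 (x_ 0%N).
Proof.
move=> Wdecr WS S0 Wsmall /choice[p pP].
have Wle m n : (m <= n)%N -> W n `<=` W m.
  move=> /subnK <-; elim: (n - m)%N => [//|k IH]; rewrite addSn.
  by apply: subset_trans IH; exact: Wdecr.
(* [g n] concatenates the first [n] paths and stays at [x_ n] up to time [s n]. Passing to [g n.+1]
   changes values only before [s n], so the sequence is eventually constant at each positive time;
   [f] below is its limit. *)
pose g := fix g n : R -> H := if n is m.+1 then
  fun t => g m t + p m (2 ^+ m.+1 * t - 1) - x_ m else fun=> x_ 0%N.
pose s n : R := 2 ^- n.
have s0 n : 0 < s n by rewrite invr_gt0 exprn_gt0.
have sS n : s n.+1 = s n / 2 by rewrite /s exprS invfM mulrC.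
have sE n t : 2 ^+ n.+1 * t = t / s n.+1 by rewrite invrK mulrC.
have gc n : continuous (g n).
  elim: n => [t|n IH t]; first exact: cvg_cst.
  apply: cvgB; last exact: cvg_cst.
  apply: cvgD; first exact: IH.
  by apply: continuous_affine_comp; have [] := pP n.
have gx n t : t <= s n -> g n t = x_ n.
  elim: n t => [//|n IH] t tn /=.
  have [_ pn _ _] := pP n; rewrite pn; last first.
    by rewrite sE subr_le0 ler_pdivrMr// mul1r.
  rewrite IH; first by rewrite addrC addKr.
  by apply: (le_trans tn); rewrite sS; have := s0 n; lra.
have gS n t : s n <= t -> g n.+1 t = g n t.
  move=> tn /=; have [_ _ pn _] := pP n; rewrite pn ?addrK//.
  rewrite sE lerBrDr ler_pdivlMr// sS; have := s0 n; lra.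
have gst n m t : (n <= m)%N -> s n <= t -> g m t = g n t.
  move=> /subnK <- tn; elim: (m - n)%N => [//|k IH]; rewrite addSn gS ?IH//.
  apply: le_trans tn; rewrite /s lef_pV2 ?posrE ?exprn_gt0//.
  by rewrite ler_weXn2l// ?leq_addl// ler1n.
have gp n t : t <= s n -> g n.+1 t = p n (2 ^+ n.+1 * t - 1).
  by move=> tn /=; rewrite gx// [x_ n + _]addrC addrK.
have gW n m t : (n <= m)%N -> t <= s n -> W n (g m t).
  move=> /subnK <- tn; elim: (m - n)%N => [|k IH].
    by rewrite add0n gx//; have [_ _ /(_ 1 (lexx _)) <-] := pP n; apply.
  rewrite addSn; have [tk|tk] := leP (s (k + n)%N) t; first by rewrite gS.
  rewrite gp ?(ltW tk)//; apply: (@Wle _ (k + n)%N); first exact: leq_addl.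
  by have [_ _ _] := pP (k + n)%N; apply.
have Nex (t : R) : 0 < t -> exists n, s n <= t.
  move=> t0; pose k := Num.truncn t^-1; exists k.+1.
  rewrite /s -[leRHS]invrK lef_pV2 ?posrE ?invr_gt0 ?exprn_gt0//.
  apply: le_trans (_ : k.+1%:R <= _); last first.
    by rewrite -natrX ler_nat ltnW// ltn_expl.
  by apply/ltW; rewrite -truncn_le_nat// /k.
pose f (t : R) : H :=
  if pselect (0 < t) is left t0 then g (projT1 (cid (Nex t t0))) t else 0.
have fE n t : s n <= t -> f t = g n t.
  move=> tn; rewrite /f; case: pselect => [t0|]; last first.
    by case; exact: lt_le_trans tn.
  case: cid => m /= tm; have [/gst ->//|/ltnW/gst ->//] := leqP n m.
have f0 t : t <= 0 -> f t = 0.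
  by move=> t0; rewrite /f; case: pselect => // t1;
    have := lt_le_trans t1 t0; rewrite ltxx.
have fW n t : 0 < t -> t <= s n -> W n (f t).
  move=> t0 tn; have [m tm] := Nex t t0.
  have [nm|mn] := leqP n m; first by rewrite (fE m)//; exact: gW.
  have tn' : s n <= t.
    apply: le_trans tm; rewrite /s lef_pV2 ?posrE ?exprn_gt0//.
    by rewrite ler_weXn2l ?ler1n// ltnW.
  by rewrite (fE n)//; exact: gW.
have s00 : s 0%N = 1 by rewrite /s expr0 invr1.
exists f; split=> //.
(* At [t <= 0] continuity comes from the smallness of the sets [W n]; at [t > 0], [f] agrees near
   [t] with a single [g n]. *)
- move=> t; have [t0|t0] := leP t 0.
    rewrite /continuous_at f0//; apply/cvgrPdist_lt => e e0.
    have [n Wn] := Wsmall e e0.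
    have tn : \forall u \near t, u < s n.
      exact: lt_nbhsl (le_lt_trans t0 (s0 n)).
    near=> u; rewrite sub0r normrN; have [u0|u0] := leP u 0.
      by rewrite f0// normr0.
    by apply/Wn/fW => //; apply/ltW; near: u.
  have [n tn] := Nex (t / 2) (divr_gt0 t0 (ltr0Sn _ 1)).
  have := gc n t; rewrite /continuous_at (fE n) ?(le_trans tn)//; last by lra.
  apply: cvg_trans; apply: near_eq_cvg; near=> u; rewrite (fE n)//.
  by apply/(le_trans tn)/ltW; near: u; apply: lt_nbhsr; lra.
- move=> t t1; rewrite (fE 0%N) ?s00//.
- move=> t; have [/f0->//|t0] := leP t 0.
  have [t1|t1] := leP t 1; first by apply/WS/fW; rewrite ?s00.
  rewrite (fE 0%N) ?s00 ?(ltW t1)// /=.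
  by have [_ _ /(_ 1 (lexx _)) <- /(_ 1)/WS] := pP 0%N.
Unshelve. all: by end_near. Qed.

End Joined.

(** * Derivatives along lines *)

Section LineDerivative.
Variables (R : realType) (E : normedModType R).

Lemma is_derive_line (E' : normedModType R) (f : E -> E') (x u y : E) (t : R) :
  x + t *: u = y -> derivable f y u ->
  is_derive t 1 (fun s : R => f (x + s *: u)) ('D_u f y).
Proof.
move=> <-.
have eqf :
    (fun h : R => h^-1 *: (((fun s : R => f (x + s *: u)) \o shift t)
      (h *: 1) - f (x + t *: u))) =
    (fun h : R => h^-1 *: ((f \o shift (x + t *: u)) (h *: u) - f (x + t *: u))).
  apply/funext => h /=; congr (_ *: (f _ - _)).
  by rewrite [h *: 1]mulr1 scalerDl addrCA.
by move=> df; split; rewrite /derivable /derive /= eqf.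
Qed.

(** Chain rule for [s |-> k * s] on the line through [x]. The case [k = -1] turns one-sided bounds
    in all directions into equalities. *)
Lemma derive_scale_dir (f : E -> R) (x u : E) (k : R) :
  derivable f x u -> derivable f x (k *: u) -> 'D_(k *: u) f x = k * 'D_u f x.
Proof.
move=> df dfk.
have df0 : is_derive (k * 0) 1 (fun s : R => f (x + s *: u)) ('D_u f x).
  by apply: is_derive_line df; rewrite mulr0 scale0r addr0.
have dfk0 : is_derive (0 : R) 1 (fun s : R => f (x + s *: (k *: u)))
    ('D_(k *: u) f x).
  by apply: is_derive_line dfk; rewrite scale0r addr0.
have dk : is_derive (0 : R) 1 (fun s : R => k * s) k.
  by have := @is_deriveZ R R R id k 0 1 1 _; rewrite [k%:A]mulr1; apply.
have e : (fun s : R => f (x + s *: (k *: u))) =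
    (fun s : R => f (x + s *: u)) \o (fun s : R => k * s).
  by apply/funext => s /=; rewrite scalerA mulrC.
have [_ d1] := dfk0; have [_ d2] := is_derive1_comp df0 dk.
by rewrite mulrC -d2 -d1 e.
Qed.

Lemma line_MVT (f : E -> R) (x h : E) :
  (forall t : R, 0 <= t <= 1 -> derivable f (x + t *: h) h) ->
  exists2 t : R, 0 <= t <= 1 & f (x + h) - f x = 'D_h f (x + t *: h).
Proof.
move=> df.
have [|||t t01] := @MVT_segment R (fun s => f (x + s *: h))
    (fun s => 'D_h f (x + s *: h)) 0 1.
- exact: ler01.
- move=> t; rewrite in_itv /= => /andP[t0 t1]; apply: is_derive_line (erefl _) _.
  by apply: df; rewrite !ltW.
- apply: derivable_within_continuous => t; rewrite in_itv /= => t01.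
  by have [] := is_derive_line (erefl _) (df _ t01).
rewrite scale1r scale0r addr0 subr0 mulr1 => ->.
by exists t => //; move: t01; rewrite in_itv.
Qed.

(** First-order condition at a minimizer of [f] plus a penalty growing at rate at most [k] along
    [u]. Only [t > 0] is examined, because the penalty may have a kink. *)
Lemma derive_lower_bound (f : E -> R) (x u : E) (k : R) :
  derivable f x u ->
  (\forall t \near (0 : R)^'+, f x - k * t <= f (x + t *: u)) ->
  - k <= 'D_u f x.
Proof.
move=> df fk; have /cvg_dnbhs_at_right fD := df.
apply: (cvgr_to_ge fD); near=> t.
have t0 : 0 < t by [].
rewrite /= -[leLHS](mulKf (lt0r_neq0 t0)) ler_pM2l ?invr_gt0//.
have : f x - k * t <= f (x + t *: u) by near: t.
by rewrite [t *: u + x]addrC; lra.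
Unshelve. all: by end_near. Qed.

Lemma norm_segment (x h : E) (t : R) : 0 <= t <= 1 ->
  `|x + t *: h| <= (1 - t) * `|x| + t * `|x + h|.
Proof.
move=> /andP[t0 t1].
have -> : x + t *: h = (1 - t) *: x + t *: (x + h).
  by rewrite scalerDr addrA -scalerDl subrK scale1r.
apply: le_trans (ler_normD _ _) _.
by rewrite !normrZ !ger0_norm ?subr_ge0.
Qed.

Lemma norm_segment_le (x h : E) (t r : R) : 0 <= t <= 1 ->
  `|x| <= r -> `|x + h| <= r -> `|x + t *: h| <= r.
Proof. by move=> t01 xr hr; have := norm_segment x h t01; move: t01; nra. Qed.

Lemma norm_segment_lt (x h : E) (t r : R) : 0 <= t <= 1 ->
  `|x| < r -> `|x + h| < r -> `|x + t *: h| < r.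
Proof.
move=> t01 xr hr; apply: (@le_lt_trans _ _ (Num.max `|x| `|x + h|)).
  by apply: norm_segment_le; rewrite // le_max lexx ?orbT.
by rewrite gt_max xr.
Qed.

End LineDerivative.

(** * Convergence and compact operators along ultrafilters *)

Section UltraFilters.
Variables (R : realType) (I : Type) (F : set_system I).

Lemma cvg_small_diameter (H : completeNormedModType R) (f : I -> H) :
  ProperFilter F ->
  (forall e : R, 0 < e -> exists2 A, F A &
    forall a b, A a -> A b -> `|f a - f b| < e) ->
  exists y : H, f @ F --> y.
Proof.
move=> FF fF; apply/cvg_ex; apply: cauchy_cvg; apply/cauchyP => e e0.
have [A FA Ae] := fF e e0; have [a Aa] := filter_ex FA.
exists (f a); suff : F (f @^-1` ball (f a) e) by [].
by apply: filterS FA => b Ab; rewrite /= -ball_normE; exact: Ae.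
Qed.

(** This replaces the extraction of subsequences: the images under [T] lie in a compact set, hence
    cluster at some [y], and along an ultrafilter a cluster point is a limit. *)
Lemma compact_operator_ultra (E : normedModType R) (T : {linear E -> E})
    (f : I -> E) (M e : R) : UltraFilter F -> compact_operator T ->
  F [set a | `|f a| <= M] -> 0 < e ->
  exists2 A, F A & forall a b, A a -> A b -> `|T (f a - f b)| <= e.
Proof.
move=> UF Tc FM e0.
have bM : bounded_set [set u : E | `|u| <= M].
  exists M; split; first exact: num_real.
  by move=> N MN u /= uM; rewrite (le_trans uM)// ltW.
have [D TD [Dc _]] := Tc _ bM.
have TFD : F ((T \o f) @^-1` D).
  by apply: filterS FM => a /= aM; apply: TD; exists (f a).
have [y [_ Ty]] := Dc ((T \o f) @ F) _ TFD.
have Fe : F [set a | `|y - T (f a)| < e / 2].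
  (* The ultrafilter contains this set or its complement, and the complement would keep the images
     away from the cluster point [y]. *)
  have [//|FN] := in_ultra_setVsetC [set a | `|y - T (f a)| < e / 2] UF.
  have [//|z [/= zN yz]] := Ty (fun z => ~ `|y - z| < e / 2) (ball y (e / 2)) FN.
    by apply: nbhsx_ballx; rewrite divr_gt0.
  by case: zN; move: yz; rewrite -ball_normE.
exists [set a | `|y - T (f a)| < e / 2] => //= a b ya yb.
rewrite linearB/= -[T (f a)](subrK y) -addrA.
by apply: le_trans (ler_normD _ _) _; rewrite -normrN opprB; lra.
Qed.

End UltraFilters.

(** * Descent for functions convex up to a compact defect *)

Definition strict_sublevel (R : realType) (H : normedModType R) (f : H -> R)
    (rho : R) : set H :=
  [set x | f x < f 0 /\ `|x| < rho].

Lemma near_ray (R : realType) (E : normedModType R) (x u : E) (P : set E) :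
  (\forall y \near x, P y) -> \forall t \near (0 : R)^'+, P (x + t *: u).
Proof.
move=> Px; apply: (@cvg_at_right_filter _ _ (fun t : R => x + t *: u) 0 x) => //.
rewrite -[in X in _ --> X](addr0 x) -(scale0r u).
by apply: cvgD; [exact: cvg_cst|apply: cvgZr_tmp; exact: cvg_id].
Qed.

Lemma near_norm_lt (R : realType) (E : normedModType R) (x : E) (d : R) :
  `|x| < d -> \forall y \near x, `|y| < d.
Proof. by move=> xd; apply: cvgr_norm_lt xd; exact: cvg_id. Qed.

Lemma near_dist_lt (R : realType) (E : normedModType R) (x : E) (d : R) :
  0 < d -> \forall y \near x, `|x - y| < d.
Proof. by move=> d0; apply: cvgr_dist_lt d0; exact: cvg_id. Qed.

(* [T] stands for the compact operator [Q 0]: up to the defect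
   [K * `|T h| ^+ 2], the function [f] is uniformly convex on the ball of radius
   [r]. *)
Section Descent.
Variables (R : realType) (H : completeNormedModType R) (f : H -> R).
Variables (T : {linear H -> H}) (r c K : R).
Hypotheses (c_gt0 : 0 < c) (K_ge0 : 0 <= K).
Hypothesis Tcompact : compact_operator T.
Hypothesis df : forall x u : H, `|x| < r -> derivable f x u.
Hypothesis cdf : forall x u : H, `|x| < r ->
  {for (x, u), continuous (fun p : H * H => 'D_(p.2) f p.1)}.
Hypothesis f_convex : forall x h : H, `|x| < r -> `|x + h| < r ->
  f x + 'D_h f x + c * `|h| ^+ 2 - K * `|T h| ^+ 2 <= f (x + h).
Hypothesis f_crit : forall x : H, `|x| < r -> (forall u, 'D_u f x = 0) -> x = 0.

Local Notation W := (strict_sublevel f).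

(** By the mean value theorem [f y - f x] is a derivative in the direction [y - x] at a point near
    [x]; joint continuity at [(x, 0)], where the derivative is [0], makes it small. *)
Lemma ball_continuous (x : H) : `|x| < r -> {for x, continuous f}.
Proof.
move=> xr; apply/cvgrPdist_lt => e e0.
have /cvgrPdist_lt/(_ e e0) := @cdf x 0 xr.
rewrite derive0 => -[[P1 P2] [/= /nbhs_ballP[d d0 dP1] /nbhs_ballP[d' d'0 dP2]] PP].
near=> y.
have xyd : `|x - y| < d by near: y; exact: near_dist_lt.
have xyd' : `|x - y| < d' by near: y; exact: near_dist_lt.
have yr : `|y| < r by near: y; exact: near_norm_lt.
have xyE : x + (y - x) = y by rewrite addrC subrK.
have [t t01|t t01] := @line_MVT _ _ f x (y - x).
  by apply: df; apply: norm_segment_lt => //; rewrite xyE.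
rewrite xyE => fE; rewrite distrC fE -normrN -sub0r.
apply: (PP (_, _)); split => /=.
  apply: dP1; rewrite -ball_normE /= opprD addNKr normrN normrZ distrC.
  by apply: le_lt_trans xyd; move: t01 => /andP[t0 t1]; rewrite ger0_norm// ler_piMl.
by apply: dP2; rewrite -ball_normE /= sub0r normrN distrC.
Unshelve. all: by end_near. Qed.

(** Apply [f_convex] from [x + t *: h] towards both endpoints, with weights [1 - t] and [t]. The
    first-order terms cancel, and the quadratic ones add up through
    [(1 - t) t^2 + t (1 - t)^2 = t (1 - t)]. *)
Lemma convex_combination_le (x h : H) (t : R) :
  0 <= t <= 1 -> `|x| < r -> `|x + h| < r ->
  f (x + t *: h) + t * (1 - t) * (c * `|h| ^+ 2 - K * `|T h| ^+ 2) <=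
  (1 - t) * f x + t * f (x + h).
Proof.
move=> t01 xr xhr; have mr := norm_segment_lt t01 xr xhr.
have [t0 t1] := andP t01.
have dZ k : 'D_(k *: h) f (x + t *: h) = k * 'D_h f (x + t *: h).
  by apply: derive_scale_dir; exact: df.
have nZ (k : R) (v : H) : `|k *: v| ^+ 2 = k ^+ 2 * `|v| ^+ 2.
  by rewrite normrZ exprMn real_normK ?num_real.
have e1 : x + t *: h + (- t) *: h = x by rewrite scaleNr addrK.
have e2 : x + t *: h + (1 - t) *: h = x + h.
  by rewrite -addrA -scalerDl [t + _]addrC subrK scale1r.
have := @f_convex (x + t *: h) ((- t) *: h) mr.
rewrite e1 => /(_ xr); rewrite dZ [T (_ *: h)]linearZ/= !nZ => le1.
have := @f_convex (x + t *: h) ((1 - t) *: h) mr.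
rewrite e2 => /(_ xhr); rewrite dZ [T (_ *: h)]linearZ/= !nZ => le2.
have t1' : 0 <= 1 - t by rewrite subr_ge0.
have := lerD (ler_wpM2l t1' le1) (ler_wpM2l t0 le2).
lra.
Qed.

(** Since [t (1 - t) <= 1], the defect raises the level on the segment by at most [K * |T h|^2],
    which the last hypothesis absorbs. The parameter [t] serves for midpoints as well as whole
    segments. *)
Lemma segment_joined (rho b : R) (x h : H) (t : R) : 0 <= t <= 1 -> rho <= r ->
  `|x| < rho -> `|x + h| < rho -> f x <= b -> f (x + h) <= b ->
  b + K * `|T h| ^+ 2 < f 0 -> joined (W rho) x (x + t *: h).
Proof.
move=> t01 rhor xr xhr xb xhb b0; apply: joined_segment => s s01.
have st01 : 0 <= s * t <= 1.
  move: s01 t01 => /andP[s0 s1] /andP[t0 t1].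
  by rewrite mulr_ge0//= mulr_ile1.
rewrite scalerA; split; last exact: norm_segment_lt.
have := convex_combination_le st01 (lt_le_trans xr rhor) (lt_le_trans xhr rhor).
move: (s * t) st01 => {t01 s01}t /andP[t0 t1]; apply: contraTlt => f0.
rewrite -ltNge.
have tt0 : 0 <= t * (1 - t) by rewrite mulr_ge0// subr_ge0.
have tt1 : t * (1 - t) <= 1 by nra.
have ch : 0 <= t * (1 - t) * (c * `|h| ^+ 2).
  by rewrite !mulr_ge0 ?subr_ge0// ltW.
have kh : t * (1 - t) * (K * `|T h| ^+ 2) <= K * `|T h| ^+ 2.
  by rewrite ler_piMl// mulr_ge0.
have bb : (1 - t) * f x + t * f (x + h) <= b by nra.
lra.
Qed.

Lemma ball_joined (S : set H) (x y : H) (d : R) :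
  (forall z, `|x - z| < d -> S z) -> `|x - y| < d -> joined S x y.
Proof.
move=> dS xyd; rewrite -[y](subrK x) addrC; apply: joined_segment => t.
move=> /andP[t0 t1]; apply: dS; rewrite opprD addNKr normrN normrZ distrC.
by apply: le_lt_trans xyd; rewrite ger0_norm// ler_piMl.
Qed.

Lemma derive_ge0_eq0 (x : H) : `|x| < r -> (forall u, 0 <= 'D_u f x) -> x = 0.
Proof.
move=> xr D0; apply: f_crit => // u; apply/eqP; rewrite eq_le D0 andbT.
have := D0 (- u); rewrite -scaleN1r derive_scale_dir; [|exact: df..].
by rewrite mulN1r oppr_ge0.
Qed.

Lemma small_multiple (d : R) : 0 < d -> exists2 e : R, 0 < e & K * e ^+ 2 <= d.
Proof.
move=> d0; have K1 : 0 < K + 1 by rewrite ltr_wpDl.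
(* For [e <= 1], [K e^2 <= (K + 1) e <= d]; dividing by [K + 1] covers [K = 0]. *)
exists (Num.min 1 (d / (K + 1))); first by rewrite lt_min ltr01 divr_gt0.
set e := Num.min _ _.
have e0 : 0 <= e by rewrite le_min ler01 divr_ge0// ltW.
have e1 : e <= 1 by rewrite ge_min lexx.
have ed : e * (K + 1) <= d by rewrite -ler_pdivlMr// ge_min lexx orbT.
nra.
Qed.

(* Minimizes [f] plus a multiple of the distance to the ball of radius [rho / 2]
   over the part of the path component of [x0] in the ball of radius
   [3 / 4 * rho]; the penalty keeps the minimizer away from the boundary. *)
Lemma almost_critical_point (rho eps : R) (x0 : H) :
  0 < rho < r -> 0 < eps -> f x0 < f 0 -> `|x0| < rho / 2 ->
  (forall y, joined (W rho) x0 y -> `|y| <= 3 / 4 * rho -> f 0 - eps < f y) ->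
  exists y, [/\ rho / 2 <= `|y|, `|y| <= 3 / 4 * rho, f 0 - eps < f y < f 0 &
    forall u, - (4 * eps / rho * `|u|) <= 'D_u f y].
Proof.
move=> /andP[rho0 rhor] eps0 fx0 x0rho f_eps.
(* With this slope the penalty at radius [3 / 4 * rho] is [kap * rho / 4 = eps]. On [C] the function
   [f] stays above [f 0 - eps], so a minimizer, where [G <= f x0 < f 0], lies strictly inside that
   radius. *)
pose kap := 4 * eps / rho; have kap0 : 0 < kap by rewrite divr_gt0// mulr_gt0.
have kaprho : kap * rho = 4 * eps by rewrite divfK// gt_eqF.
pose N (x : H) := Num.max 0 (`|x| - rho / 2).
have N0 x : 0 <= N x by rewrite le_max lexx.
have NN x : `|x| - rho / 2 <= N x by rewrite le_max lexx orbT.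
have Nle x k : 0 <= k -> `|x| - rho / 2 <= k -> N x <= k.
  by move=> k0 xk; rewrite ge_max k0.
pose G x := f x + kap * N x.
pose C := [set y | joined (W rho) x0 y /\ `|y| <= 3 / 4 * rho].
have Cx0 : C x0.
  split; last by lra.
  by apply: joined_refl; split => //; lra.
have fG y : f y <= G y by rewrite lerDl mulr_ge0// ltW.
pose g := inf [set G y | y in C].
have hasg : has_inf [set G y | y in C].
  split; first by exists (G x0), x0.
  exists (f 0 - eps) => _ [y [Cy yrho] <-]; apply: le_trans (fG y).
  by apply/ltW/f_eps.
have gle y : C y -> g <= G y.
  by move=> Cy; apply: ge_inf; [exact: hasg.2|exists y].
have Gx0 : G x0 = f x0.
  by rewrite /G (_ : N x0 = 0) ?mulr0 ?addr0//; apply/max_idPl; lra.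
have gx0 : g <= f x0 by rewrite -Gx0; exact: gle.
have /choice[x_ x_P] : forall n : nat, exists x, C x /\ G x < g + n.+1%:R^-1.
  move=> n; have [|_ [x Cx <-] Gx] := @inf_adherent _ _ n.+1%:R^-1 _ hasg.
    by rewrite invr_gt0.
  by exists x.
have [F [UF Foo]] := ultraFilterLemma (@eventually_filter).
have Fsmall e : 0 < e -> F [set n | G (x_ n) < g + e].
  move=> e0; apply: Foo; near=> n; apply: lt_trans (x_P n).2 _.
  by rewrite ltrD2l; near: n; exact: near_infty_natSinv_lt (PosNum e0).
have [y xy] : exists y : H, x_ @ F --> y.
  apply: cvg_small_diameter => e e0.
  (* The first bound keeps segments between almost minimizers below level [f 0], as [g <= f x0]; the
     second makes uniform convexity force the distance below [e]. *)
  pose d := Num.min ((f 0 - f x0) / 4) (c * e ^+ 2 / 8).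
  have d0 : 0 < d by rewrite lt_min !divr_gt0 ?subr_gt0 ?mulr_gt0 ?exprn_gt0.
  have dl : d <= (f 0 - f x0) / 4 by rewrite ge_min lexx.
  have dr : d <= c * e ^+ 2 / 8 by rewrite ge_min lexx orbT.
  have [eta eta0 Keta] := small_multiple d0.
  have bounded_x : F [set n | `|x_ n| <= 3 / 4 * rho].
    by apply: filterS filterT => n _ /=; exact: (x_P n).1.2.
  have [A FA AT] := compact_operator_ultra UF Tcompact bounded_x eta0.
  exists (A `&` [set n | G (x_ n) < g + d]); first exact: filterI FA (Fsmall _ d0).
  move=> b a [Ab Gb] [Aa Ga]; rewrite /= in Ga Gb.
  set h := x_ b - x_ a.
  have hE : x_ a + h = x_ b by rewrite addrC subrK.
  have KT : K * `|T h| ^+ 2 <= d.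
    apply: le_trans Keta; apply: ler_wpM2l => //.
    by rewrite ler_sqr ?nnegrE// ?AT// ltW.
  have [[ja na] _] := x_P a; have [[jb nb] _] := x_P b.
  have na' : `|x_ a| < rho by apply: le_lt_trans na _; lra.
  have nb' : `|x_ a + h| < rho by rewrite hE; apply: le_lt_trans nb _; lra.
  have half01 : 0 <= (2^-1 : R) <= 1 by lra.
  (* The midpoint of two almost minimizers is still in [C], so [G] is at least [g] there. As [f] is
     uniformly convex up to the defect and [N] is convex, this gives [c * |h|^2 < 5 d]. *)
  have Cm : C (x_ a + 2^-1 *: h).
    split; last by apply: norm_segment_le => //; rewrite hE.
    apply: joined_trans ja _.
    apply: (@segment_joined rho (g + d)) => //.
    - exact: ltW.
    - by apply/ltW/(le_lt_trans (fG _)).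
    - by rewrite hE; apply/ltW/(le_lt_trans (fG _)).
    - lra.
  have := gle _ Cm; rewrite /G.
  have := convex_combination_le half01 (lt_trans na' rhor) (lt_trans nb' rhor).
  have Nm : N (x_ a + 2^-1 *: h) <= (N (x_ a) + N (x_ b)) / 2.
    apply: Nle; first by have := N0 (x_ a); have := N0 (x_ b); lra.
    have := norm_segment (x_ a) h half01; rewrite hE.
    by have := NN (x_ a); have := NN (x_ b); lra.
  have := ler_wpM2l (ltW kap0) Nm; rewrite hE.
  move: Ga Gb; rewrite /G => Ga Gb kN fm gm.
  have h2 : `|h| ^+ 2 < e ^+ 2 by rewrite -(ltr_pM2l c_gt0); lra.
  by move: h2; rewrite ltr_sqr ?nnegrE// ltW.
have yle : `|y| <= 3 / 4 * rho.
  apply: (cvgr_to_le (cvg_norm xy)); apply: filterS filterT => n _.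
  exact: (x_P n).1.2.
have yrho : `|y| < rho by apply: le_lt_trans yle _; lra.
have yr : `|y| < r by exact: lt_trans rhor.
have fy := ball_continuous yr.
have Gy : G y <= g.
  have Gcvg : G (x_ n) @[n --> F] --> G y.
    apply: cvgD; first exact: (cvg_comp _ _ xy fy).
    apply: cvgMl_tmp.
    have cN : {for y, continuous N}.
      apply: continuous_max; first exact: cvg_cst.
      by apply: cvgB; [apply: cvg_norm; exact: cvg_id|exact: cvg_cst].
    exact: (cvg_comp _ _ xy cN).
  apply/ler_addgt0Pr => e e0; apply: (cvgr_to_le Gcvg).
  by apply: filterS (Fsmall e e0) => n /ltW.
have fy0 : f y < f 0 by rewrite (le_lt_trans (fG y))// (le_lt_trans Gy)//
  (le_lt_trans gx0).
(* The limit [y] is brought back into the path component of [x0] by a segment to some [x_ n] inside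
   a ball contained in [W rho]. *)
have : \forall z \near y, W rho z.
  near=> z; split; last by near: z; exact: near_norm_lt.
  by near: z; exact: cvgr_lt fy _ fy0.
move=> /nbhs_ballP[d /= d0 dW].
have {}dW z : `|y - z| < d -> W rho z by move=> yz; apply: dW; rewrite -ball_normE.
have [n xn] := filter_ex ((cvgrPdist_lt _ _).1 xy d d0).
have jy : joined (W rho) x0 y.
  apply: joined_trans (x_P n).1.1 _; apply: joined_sym.
  exact: ball_joined dW xn.
have fey := f_eps y jy yle.
have ylt : `|y| < 3 / 4 * rho.
  have := NN y; rewrite -(ler_pM2l kap0) => kN.
  by rewrite -(ltr_pM2l kap0); move: Gy; rewrite /G; lra.
have ymin u : \forall t \near (0 : R)^'+, G y <= G (y + t *: u).
  apply: (@near_ray _ _ y u (fun z => G y <= G z)); near=> z.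
  apply: (le_trans Gy); apply: gle; split.
    apply: joined_trans jy (ball_joined dW _).
    by near: z; exact: near_dist_lt.
  by apply/ltW; near: z; exact: near_norm_lt.
exists y; split => //.
(* Below radius [rho / 2] the penalty vanishes near [y], so [y] would be critical for [f], hence
   [0], against [f y < f 0]. *)
- rewrite leNgt; apply/negP => yrho2.
  suff y0 : y = 0 by rewrite y0 ltxx in fy0.
  apply: derive_ge0_eq0 => // u; rewrite -oppr0.
  apply: derive_lower_bound; first exact: df.
  have Ny : \forall t \near (0 : R)^'+, N (y + t *: u) <= 0.
    apply: (@near_ray _ _ y u (fun z => N z <= 0)); near=> z.
    apply: Nle => //; rewrite subr_le0.
    by apply/ltW; near: z; exact: near_norm_lt.
  near=> t.
  have : G y <= G (y + t *: u) by near: t.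
  have : kap * N (y + t *: u) <= 0.
    by apply: mulr_ge0_le0; [exact: ltW|near: t].
  by have := fG y; rewrite mul0r /G; lra.
- by rewrite fey.
(* [N] is 1-Lipschitz, so the penalty grows along [u] at rate at most [kap * |u|]. *)
- move=> u; apply: derive_lower_bound; first exact: df.
  near=> t; have t0 : 0 < t by [].
  have : G y <= G (y + t *: u) by near: t.
  rewrite /G; have : kap * N (y + t *: u) <= kap * (N y + t * `|u|).
    rewrite ler_pM2l//; apply: Nle; first by rewrite addr_ge0// mulr_ge0// ltW.
    have := ler_normD y (t *: u); rewrite normrZ gtr0_norm//.
    by have := NN y; lra.
  by rewrite -/kap; lra.
Unshelve. all: by end_near. Qed.

(** If every [eps = 1 / (n + 1)] failed, there would be almost critical points [y_ n]. They converge
    along an ultrafilter to a point with nonnegative directional derivatives, that is to [0],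
    although their norms are at least [rho / 2]. *)
Lemma descent_below (rho : R) : 0 < rho < r -> exists2 eps : R, 0 < eps &
  forall x, f x < f 0 -> `|x| < rho / 2 ->
  exists y, [/\ joined (W rho) x y, `|y| <= 3 / 4 * rho & f y <= f 0 - eps].
Proof.
move=> rhor; have /andP[rho0 rho_r] := rhor.
apply: contrapT => noeps.
have /choice[y_ y_P] : forall n : nat, exists y : H, let eps := n.+1%:R^-1 in
    [/\ rho / 2 <= `|y|, `|y| <= 3 / 4 * rho, f 0 - eps < f y < f 0 &
    forall u, - (4 * eps / rho * `|u|) <= 'D_u f y].
  move=> n; set eps : R := n.+1%:R^-1.
  have eps0 : 0 < eps by rewrite invr_gt0.
  apply: contrapT => noy; apply: noeps; exists eps => // x fx xrho.
  apply: contrapT => nox; apply: noy.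
  apply: (@almost_critical_point rho eps x) => // y jy yrho.
  by rewrite ltNge; apply/negP => fy; apply: nox; exists y.
have [F [UF Foo]] := ultraFilterLemma (@eventually_filter).
have small (d : R) : 0 < d -> F [set n | n.+1%:R^-1 < d].
  by move=> d0; have := near_infty_natSinv_lt (PosNum d0); exact: Foo.
have bounded_y : F [set n | `|y_ n| <= 3 / 4 * rho].
  by apply: filterS filterT => n _; have [] := y_P n.
have [y yy] : exists y : H, y_ @ F --> y.
  apply: cvg_small_diameter => e e0.
  (* In [f_convex] between [y_ a] and [y_ b], the defect costs at most [d], the level gap
     [1 / (a + 1)] and the slope [8 / (a + 1)]. The total is below [d + 9 d / 8 < 4 d = c e^2]. *)
  have ce : 0 < c * e ^+ 2 / 4 by rewrite divr_gt0// mulr_gt0// exprn_gt0.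
  pose d := c * e ^+ 2 / 4.
  have [eta eta0 Keta] := small_multiple ce.
  have [A FA AT] := compact_operator_ultra UF Tcompact bounded_y eta0.
  exists (A `&` [set n | n.+1%:R^-1 < d] `&` [set n | n.+1%:R^-1 < d / 8]).
    apply: filterI (filterI FA (small _ ce)) _.
    by apply: small; rewrite divr_gt0.
  move=> b a [[Ab db] db8] [[Aa da] da8]; rewrite /= in db db8 da da8.
  have [_ na /andP[fa fa0] Da] := y_P a.
  have [_ nb /andP[fb fb0] _] := y_P b.
  have hE : y_ a + (y_ b - y_ a) = y_ b by rewrite addrC subrK.
  have na' : `|y_ a| < r by apply: le_lt_trans na _; lra.
  have nb' : `|y_ b| < r by apply: le_lt_trans nb _; lra.
  have := @f_convex (y_ a) (y_ b - y_ a) na'; rewrite hE => /(_ nb').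
  have := Da (y_ b - y_ a).
  have : K * `|T (y_ b - y_ a)| ^+ 2 <= d.
    apply: le_trans Keta; apply: ler_wpM2l => //.
    by rewrite ler_sqr ?nnegrE// ?AT// ltW.
  have : `|y_ b - y_ a| <= 2 * rho.
    by apply: le_trans (ler_normB _ _) _; lra.
  move: (y_ b - y_ a) => h hrho KT Dh.
  have {}hrho : 4 * a.+1%:R^-1 / rho * `|h| <= 8 * a.+1%:R^-1.
    apply: (le_trans (ler_wpM2l _ hrho)).
      by rewrite divr_ge0 ?mulr_ge0 ?invr_ge0// ltW.
    have -> // : forall v, 4 * v / rho * (2 * rho) = 8 * v.
    by move=> v; field; rewrite gt_eqF.
  move=> fh; have dE : d = c * e ^+ 2 / 4 by [].
  have {Dh Da}hrho := le_trans (etrans (lerN2 _ _) hrho) Dh.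
  have h2 : `|h| ^+ 2 < e ^+ 2.
    rewrite -(ltr_pM2l c_gt0).
    by move: (a.+1%:R^-1) da8 fa hrho => v; lra.
  by move: h2; rewrite ltr_sqr ?nnegrE// ltW.
have yle : `|y| <= 3 / 4 * rho.
  by apply: (cvgr_to_le (cvg_norm yy)); exact: bounded_y.
have yge : rho / 2 <= `|y|.
  apply: (cvgr_to_ge (cvg_norm yy)); apply: filterS filterT => n _.
  by have [] := y_P n.
have yr : `|y| < r by apply: le_lt_trans yle _; lra.
suff y0 : y = 0 by move: yge; rewrite y0 normr0; lra.
apply: derive_ge0_eq0 => // u.
have Dcvg : 'D_u f (y_ n) @[n --> F] --> 'D_u f y.
  apply: (cvg_comp (fun n => (y_ n, u)) _ _ (@cdf y u yr)).
  by apply: cvg_pair; [exact: yy|exact: cvg_cst].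
apply/ler_addgt0Pr => e e0; rewrite -lerBlDr sub0r.
apply: (cvgr_to_ge Dcvg).
have k0 : 0 < rho * e / (4 * (`|u| + 1)) by rewrite divr_gt0 ?mulr_gt0// ltr_wpDl.
apply: filterS (small _ k0) => n /= nk; have [_ _ _ Du] := y_P n.
apply: le_trans (Du u); rewrite lerN2 mulrAC ler_pdivrMr//.
have n0 : 0 <= n.+1%:R^-1 :> R by rewrite invr_ge0.
move: nk; rewrite ltr_pdivlMr ?mulr_gt0 ?ltr_wpDl//.
by move: (n.+1%:R^-1) n0 => v; lra.
Qed.

(** Each point is first moved by [phi] down to level [f 0 - eps]. On a set of the ultrafilter the
    images under [phi] are close for [|T h|], and the room [eps] lets segments join them. *)
Lemma ultra_joined (F : set_system H) (rho : R) :
  UltraFilter F -> nbhs 0 `<=` F -> F [set x | f x < f 0] -> 0 < rho < r ->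
  exists2 A, F A & forall x y, A x -> A y -> joined (W rho) x y.
Proof.
move=> UF F0 Ff rhor; have /andP[rho0 rho_r] := rhor.
have [eps eps0 epsP] := descent_below rhor.
have /choice[phi phiP] : forall x : H, exists y, f x < f 0 -> `|x| < rho / 2 ->
    [/\ joined (W rho) x y, `|y| <= 3 / 4 * rho & f y <= f 0 - eps].
  move=> x; have [[fx xrho]|nx] := pselect (f x < f 0 /\ `|x| < rho / 2).
    by have [y yP] := epsP x fx xrho; exists y.
  by exists 0 => fx xrho; case: nx.
have Frho : F [set x | f x < f 0 /\ `|x| < rho / 2].
  apply: filterI Ff _; apply: F0; apply: near_norm_lt; rewrite normr0.
  by rewrite divr_gt0.
have Fphi : F [set x | `|phi x| <= 3 / 4 * rho].
  by apply: filterS Frho => x /= [fx xrho]; have [] := phiP x fx xrho.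
have eps2 : 0 < eps / 2 by rewrite divr_gt0.
have [eta eta0 Keta] := small_multiple eps2.
have [A FA AT] := compact_operator_ultra UF Tcompact Fphi eta0.
exists (A `&` [set x | f x < f 0 /\ `|x| < rho / 2]); first exact: filterI.
move=> x y [Ax [fx xrho]] [Ay [fy yrho]].
have [jx nx lx] := phiP x fx xrho; have [jy ny ly] := phiP y fy yrho.
apply: joined_trans jx _; apply: joined_trans (joined_sym jy).
have hE : phi x + (phi y - phi x) = phi y by rewrite addrC subrK.
have nx' : `|phi x| < rho by apply: le_lt_trans nx _; lra.
have ny' : `|phi y| < rho by apply: le_lt_trans ny _; lra.
have KT : K * `|T (phi y - phi x)| ^+ 2 <= eps / 2.
  apply: le_trans Keta; apply: ler_wpM2l => //.
  by rewrite ler_sqr ?nnegrE// ?AT// ltW.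
have := @segment_joined rho (f 0 - eps) (phi x) (phi y - phi x) 1.
rewrite scale1r hE ler01 lexx; apply => //; first exact: ltW.
by lra.
Qed.

Lemma joined_origin : 0 < r -> ~ (\forall x \near 0, f 0 <= f x) ->
  exists y, y != 0 /\ joined [set x | f x <= f 0 /\ `|x| < r] 0 y.
Proof.
move=> r0 nmin.
have PF : ProperFilter (within [set x | f x < f 0] (nbhs (0 : H))).
  apply: Build_ProperFilter_ex => P; rewrite /within /= => nP.
  apply: contrapT => noP; apply: nmin; apply: filterS nP => x xP.
  by rewrite leNgt; apply/negP => fx; apply: noP; exists x; exact: xP.
have [F [UF FF]] := ultraFilterLemma PF.
have F0 : nbhs (0 : H) `<=` F.
  by move=> P P0; apply: FF; apply: filterS P0 => x Px.
have Ff : F [set x | f x < f 0] by apply: FF; exact: withinT.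
pose rho n : R := r / 2 ^+ n.+1.
have rho0 n : 0 < rho n by rewrite divr_gt0// exprn_gt0.
have rhoS n : rho n.+1 = rho n / 2.
  by rewrite /rho [in LHS]exprS; field; rewrite expf_neq0.
have rhor n : 0 < rho n < r.
  rewrite rho0/= ltr_pdivrMr ?exprn_gt0// ltr_pMr//.
  by rewrite exprn_egt1// ltr1n.
have /choice[A AP] : forall n, exists A, F A /\
    forall x y, A x -> A y -> joined (W (rho n)) x y.
  by move=> n; have [A FA AP] := ultra_joined UF F0 Ff (rhor n); exists A.
(* Thus [x_ n] and [x_ n.+1] both lie in [A n], which joins them in the ball of radius [rho n]; at
   [n = 0] the predecessor is again [0]. *)
have /choice[x_ xP] : forall n, exists x, (A n `&` A n.-1) x.
  by move=> n; exact: (@filter_ex _ F _ _ (filterI (AP n).1 (AP n.-1).1)).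
exists (x_ 0%N); split.
  apply/eqP => x00; have [Ax _] := xP 0%N.
  have [[]] := joined_mem ((AP 0%N).2 _ _ Ax Ax).
  by rewrite x00 ltxx.
apply: (@joined_limit _ _ (fun n => W (rho n))).
- move=> n x [fx xn]; split=> //; apply: (lt_trans xn); rewrite rhoS.
  by have := rho0 n; lra.
- move=> x [fx x0]; split; first exact: ltW.
  by apply: lt_trans x0 _; have /andP[] := rhor 0%N.
- by split; rewrite ?normr0.
- move=> e e0; pose n := Num.truncn (r / e); exists n => x [_ xn].
  apply: (lt_trans xn); rewrite ltr_pdivrMr ?exprn_gt0// mulrC -ltr_pdivrMr//.
  apply: (@lt_le_trans _ _ n.+1%:R); first by rewrite -truncn_le_nat.
  by rewrite -natrX ler_nat ltnW// ltn_expl.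
- move=> n; apply: (AP n).2; [exact: (xP n.+1).2|exact: (xP n).1].
Qed.

End Descent.

(** * The second-order estimate *)

Section InnerProduct.
Variables (R : realType) (H : normedModType R) (ip : {dot H for idfun}).
Hypothesis ip_norm : forall u : H, `|u| ^+ 2 = ip u u.

Lemma dot_sqr_normD (s : R) (u v : H) :
  `|u + s *: v| ^+ 2 = `|u| ^+ 2 + 2 * s * ip u v + s ^+ 2 * `|v| ^+ 2.
Proof.
have ipC : ip v u = ip u v by rewrite hermC expr0 mul1r.
have Dl x y z : ip (x + y) z = ip x z + ip y z by rewrite linearDl.
have Dr x y z : ip z (x + y) = ip z x + ip z y by rewrite linearDr.
have Zl x z : ip (s *: x) z = s * ip x z by rewrite linearZl_LR.
have Zr x z : ip z (s *: x) = s * ip z x by rewrite linearZr_LR.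
rewrite !ip_norm Dl !Dr !Zl !Zr ipC; ring.
Qed.

Lemma dot_polarization (u v : H) :
  ip u v = (`|u + v| ^+ 2 - `|u| ^+ 2 - `|v| ^+ 2) / 2.
Proof. by have := dot_sqr_normD 1 u v; rewrite scale1r => ->; field. Qed.

Lemma dot_continuousl (v : H) : continuous (fun u => ip u v).
Proof.
have -> : (fun u => ip u v) =
    (fun u => (`|u + v| * `|u + v| - `|u| * `|u| - `|v| * `|v|) / 2).
  by apply/funext => u; rewrite dot_polarization !expr2.
have cn : continuous (fun u : H => `|u|) by move=> u; exact: norm_continuous.
have cnD : continuous (fun u : H => `|u + v|).
  by move=> u; apply: cvg_norm; apply: cvgD; [exact: cvg_id|exact: cvg_cst].
move=> u; apply: cvgMr_tmp; apply: cvgB; last exact: cvg_cst.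
by apply: cvgB; apply: cvgM; [exact: cnD|exact: cnD|exact: cn|exact: cn].
Qed.

(** Young's inequality: expand [|u + 2 s v|^2 >= 0] and divide by [4 s]. *)
Lemma dot_lower_bound (s : R) (u v : H) : 0 < s ->
  - (`|u| ^+ 2 / (4 * s) + s * `|v| ^+ 2) <= ip u v.
Proof.
move=> s0; have := sqr_ge0 `|u + (2 * s) *: v|; rewrite dot_sqr_normD => le0.
rewrite lerNl -lerBlDr ler_pdivlMr ?mulr_gt0//; lra.
Qed.
End InnerProduct.

Lemma compact_operator_continuous (R : realType) (E : normedModType R)
    (T : {linear E -> E}) : compact_operator T -> continuous T.
Proof.
move=> Tc; apply: bounded_linear_continuous.
have b1 : bounded_set [set u : E | `|u| <= 1].
  exists 1; split; first exact: num_real.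
  by move=> N N1 u /= u1; rewrite (le_trans u1)// ltW.
have [D TD [/compact_bounded[M [_ DM]] _]] := Tc _ b1.
exists M; split; first exact: num_real.
move=> N MN; have : \forall u \near (0 : E), `|u| < 1.
  by apply: near_norm_lt; rewrite normr0.
by apply: filterS => u u1; apply: (DM N MN); apply: TD; exists u; rewrite //= ltW.
Qed.

Lemma is_derive_linear_comp (R : realType) (E E' : normedModType R)
    (l : {linear E -> E'}) (g : R -> E) (t : R) (dg : E) :
  continuous l -> is_derive t 1 g dg -> is_derive t 1 (l \o g) (l dg).
Proof.
move=> cl [dgt <-].
have lE : (fun h : R => h^-1 *: (((l \o g) \o shift t) (h *: 1) - (l \o g) t)) =
    l \o (fun h : R => h^-1 *: ((g \o shift t) (h *: 1) - g t)).
  by apply/funext => h /=; rewrite -linearB -linearZ.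
have lcvg : (l \o (fun h : R => h^-1 *: ((g \o shift t) (h *: 1) - g t))) @ 0^'
    --> l ('D_1 g t) by apply: (cvg_comp _ _ dgt); exact: cl.
split; first by rewrite /derivable lE; apply/cvg_ex; eexists; exact: lcvg.
by rewrite /derive lE; apply/cvg_lim => //.
Qed.

(** No continuity of [g2] is assumed, so an integral remainder is replaced by two uses of the mean
    value theorem: for [g1], then for [g] minus the parabola [g1 0 * t + m / 2 * t^2]. *)
Lemma taylor2_lower_bound (R : realType) (g g1 g2 : R -> R) (m : R) :
  (forall t : R, 0 <= t <= 1 -> is_derive t 1 g (g1 t)) ->
  (forall t : R, 0 <= t <= 1 -> is_derive t 1 g1 (g2 t)) ->
  (forall t : R, 0 <= t <= 1 -> m <= g2 t) ->
  g 0 + g1 0 + m / 2 <= g 1.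
Proof.
move=> dg dg1 mg2.
have g1m (t : R) : 0 <= t <= 1 -> g1 0 + m * t <= g1 t.
  move=> /andP[t0 t1].
  have [|||s] := @MVT_segment R g1 g2 0 t => //.
  - move=> s; rewrite in_itv /= => /andP[s0 st]; apply: dg1.
    by rewrite (ltW s0)/= ltW// (lt_le_trans st).
  - apply: derivable_within_continuous => s; rewrite in_itv /= => /andP[s0 st].
    by have [] := dg1 s; rewrite ?s0 ?(le_trans st).
  rewrite in_itv /= subr0 => /andP[s0 st] g1E.
  have : m * t <= g2 s * t by rewrite ler_wpM2r// mg2// s0 (le_trans st).
  by rewrite -g1E; lra.
pose k : R -> R := g - (g1 0 \*: (id : R -> R) + (m / 2) \*: ((id : R -> R) ^+ 2)).
have dk (t : R) : 0 <= t <= 1 -> is_derive t 1 k (g1 t - (g1 0 + m * t)).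
  move=> t01; have := dg t t01 => dgt; apply: is_derive_eq.
  by rewrite /GRing.scale /= !mulr1; field.
have [|||s s01] := @MVT_segment R k (fun t => g1 t - (g1 0 + m * t)) 0 1 => //.
- by move=> s; rewrite in_itv /= => /andP[s0 s1]; apply: dk; rewrite !ltW.
- apply: derivable_within_continuous => s; rewrite in_itv /= => s01.
  by have [] := dk s s01.
rewrite in_itv/= in s01; have := g1m s s01.
have kE t : k t = g t - (g1 0 * t + m / 2 * (t * t)) by [].
by rewrite !kE; lra.
Qed.

Section Admissible.
Variables (R : realType) (H : completeNormedModType R).
Variables (ip : {dot H for idfun}) (X : completeNormedModType R).
Variables (j : {linear X -> H}) (V : set H) (L : H -> R) (A : X -> X).
Variables (B P Q : X -> {linear H -> H}).
Hypothesis adm : admissible ip j V L A B P Q.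

(** (D4) only speaks of sequences: if no constant worked on any ball, counterexamples for
    [1 / (n + 1)] would form a sequence violating it. *)
Lemma P_uniformly_positive : exists2 C : R, 0 < C & exists2 d : R, 0 < d &
  forall (x : X) (u : H), V (j x) -> `|j x| < d -> C * `|u| ^+ 2 <= ip (P x u) u.
Proof.
apply: contrapT => nP.
have /choice[x_ xP] : forall n : nat, exists x, [/\ V (j x),
    `|j x| < n.+1%:R^-1 & exists u, ip (P x u) u < n.+1%:R^-1 * `|u| ^+ 2].
  move=> n; apply: contrapT => nx; apply: nP.
  exists n.+1%:R^-1; first by rewrite invr_gt0.
  exists n.+1%:R^-1; first by rewrite invr_gt0.
  move=> x u Vx xn; rewrite leNgt; apply/negP => Pu.
  by apply: nx; exists x; split=> //; exists u.
have Vx k : V (j (x_ k)) by have [] := xP k.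
have x0 : `|j (x_ k)| @[k --> \oo] --> 0.
  apply/cvgrPdist_lt => e e0; near=> k; rewrite sub0r normrN normr_id.
  have [_ xk _] := xP k; apply: lt_trans xk _.
  by near: k; exact: near_infty_natSinv_lt (PosNum e0).
have [C C0 [n0 CP]] := adm_D4 adm Vx x0.
suff [n [nn nC]] : exists n, (n0 <= n)%N /\ n.+1%:R^-1 < C.
  have [_ _ [u]] := xP n; rewrite ltNge => /negP; apply.
  by apply: le_trans (CP n u nn); rewrite ler_wpM2r// ltW.
near \oo => n; exists n; split; near: n; first exact: nbhs_infty_ge.
exact: near_infty_natSinv_lt (PosNum C0).
Unshelve. all: by end_near. Qed.

Lemma hessian_lower_bound : exists c K d : R, [/\ 0 < c, 0 <= K, 0 < d &
  forall (x : X) (u : H), V (j x) -> `|j x| < d ->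
    c * `|u| ^+ 2 - K * `|Q 0 u| ^+ 2 <= ip (B x u) u].
Proof.
have [C C0 [d d0 Cd]] := P_uniformly_positive.
(* Of the constant [C] from [P], Young's inequality spends [C / 4] on [Q 0 u] and twice [C / 8] on
   [Q x u - Q 0 u], which leaves [C / 2]. *)
have C4 : 0 < C / 4 by rewrite divr_gt0.
have [d' d'0 dQ] := adm_D3 adm C4.
exists (C / 2), C^-1, (Num.min d d'); split.
- by rewrite divr_gt0.
- by rewrite invr_ge0 ltW.
- by rewrite lt_min d0.
move=> x u Vx; rewrite lt_min => /andP[xd xd'].
rewrite (adm_D_decomp adm Vx).
have -> : P x u + Q x u = P x u + (Q 0 u + (Q x u - Q 0 u)).
  by rewrite [Q 0 u + _]addrC subrK.
have Dl a b z : ip (a + b) z = ip a z + ip b z by rewrite linearDl.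
rewrite Dl (Dl (Q 0 u)).
have Pu := Cd x u Vx xd.
have := dot_lower_bound (adm_ip_norm adm) (Q 0 u) u C4.
have -> : `|Q 0 u| ^+ 2 / (4 * (C / 4)) = C^-1 * `|Q 0 u| ^+ 2.
  by field; rewrite gt_eqF.
move: (C^-1 * _) => w Q0u.
have C8 : 0 < C / 8 by rewrite divr_gt0.
have := dot_lower_bound (adm_ip_norm adm) (Q x u - Q 0 u) u C8.
have : `|Q x u - Q 0 u| ^+ 2 / (4 * (C / 8)) <= C / 8 * `|u| ^+ 2.
  rewrite ler_pdivrMr ?mulr_gt0//.
  have -> : C / 8 * `|u| ^+ 2 * (4 * (C / 8)) = (C / 4 * `|u|) ^+ 2 by field.
  by rewrite ler_sqr ?nnegrE ?dQ// mulr_ge0// ltW.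
move: (_ / (4 * (C / 8))) => v vle Qu.
lra.
Qed.

Lemma j_continuous : continuous j.
Proof.
apply: bounded_linear_continuous; apply/linear_boundedP; near=> M => x.
apply: le_trans (adm_j_norm adm x) _; rewrite ler_peMl//.
Unshelve. all: by end_near. Qed.

Lemma adm_derivable (x u : H) : V x -> derivable L x u.
Proof. by have [+ _] := adm_F1 adm; apply. Qed.

Lemma adm_derive_continuous (x u : H) : V x ->
  {for (x, u), continuous (fun p : H * H => 'D_(p.2) L p.1)}.
Proof.
move=> Vx; have [_] := adm_F1 adm; rewrite continuous_open_subspace.
  by apply; rewrite inE.
rewrite openE => -[y v] [/= Vy _]; exists (V, setT) => //=; split.
  by apply: open_nbhs_nbhs; split => //; exact: adm_V_open adm.
exact: filterT.
Qed.

Lemma taylor_lower_bound_on_X (c K d r : R) :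
  (forall (x : X) (u : H), V (j x) -> `|j x| < d ->
    c * `|u| ^+ 2 - K * `|Q 0 u| ^+ 2 <= ip (B x u) u) ->
  (forall x : H, `|x| < r -> V x) -> r <= d ->
  forall x h : X, `|j x| < r -> `|j x + j h| < r ->
  L (j x) + 'D_(j h) L (j x) + c / 2 * `|j h| ^+ 2 - K / 2 * `|Q 0 (j h)| ^+ 2
  <= L (j x + j h).
Proof.
move=> hess rV rd x h xr xhr.
have jE (t : R) : j (x + t *: h) = j x + t *: j h by rewrite linearD linearZ.
have jr (t : R) : 0 <= t <= 1 -> `|j (x + t *: h)| < r.
  by move=> t01; rewrite jE; exact: norm_segment_lt.
(* Composed with [A] along the segment, this continuous functional on [X] gives the first derivative
   of [L] in the direction [j h]; differentiating [A] then brings in [B]. *)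
pose l (v : X) := ip (j v) (j h).
have l_linear : linear l.
  by move=> a u v; rewrite /l linearP linearDl /= linearZl_LR.
pose lL : {linear X -> R} := HB.pack l (GRing.isLinear.Build R X R _ l l_linear).
have cl : continuous lL.
  move=> v; apply: (@continuous_comp _ _ _ j (fun u => ip u (j h))).
    exact: j_continuous.
  exact: dot_continuousl (adm_ip_norm adm) _ _.
pose g (t : R) := L (j x + t *: j h).
pose g1 := lL \o (fun t : R => A (x + t *: h)).
pose g2 (t : R) := ip (B (x + t *: h) (j h)) (j h).
have g1E (t : R) : 0 <= t <= 1 -> 'D_(j h) L (j x + t *: j h) = g1 t.
  by move=> /jr/rV Vt; rewrite -jE (adm_F2_grad adm).
have dg (t : R) : 0 <= t <= 1 -> is_derive t 1 g (g1 t).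
  move=> t01; rewrite -g1E//; apply: is_derive_line (erefl _) _.
  by apply: adm_derivable; rewrite -jE; apply/rV/jr.
have dg1 (t : R) : 0 <= t <= 1 -> is_derive t 1 g1 (g2 t).
  move=> /jr/rV Vt; rewrite /g2 -(adm_F3_hess adm)//.
  apply: (@is_derive_linear_comp _ _ _ lL _ _ _ cl).
  by apply: is_derive_line (erefl _) _; have [+ _] := adm_F2_cdd adm; apply.
pose m := c * `|j h| ^+ 2 - K * `|Q 0 (j h)| ^+ 2.
have mg2 (t : R) : 0 <= t <= 1 -> m <= g2 t.
  by move=> /jr tr; apply: hess; [exact: rV|exact: lt_le_trans rd].
have := taylor2_lower_bound dg dg1 mg2.
have <- : 'D_(j h) L (j x) = g1 0.
  by rewrite -g1E ?lexx ?ler01// scale0r addr0.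
rewrite /g scale0r addr0 scale1r /m; lra.
Qed.

(** Both sides are continuous in [(x, h)] for the norm of [H], so a strict failure would persist on
    a neighborhood, which meets the dense range of [j]. *)
Lemma taylor_lower_bound (c K d r : R) :
  (forall (x : X) (u : H), V (j x) -> `|j x| < d ->
    c * `|u| ^+ 2 - K * `|Q 0 u| ^+ 2 <= ip (B x u) u) ->
  (forall x : H, `|x| < r -> V x) -> r <= d ->
  forall x h : H, `|x| < r -> `|x + h| < r ->
  L x + 'D_h L x + c / 2 * `|h| ^+ 2 - K / 2 * `|Q 0 h| ^+ 2 <= L (x + h).
Proof.
move=> hess rV rd x h xr xhr; rewrite leNgt; apply/negP => Lxh.
have Q0c : continuous (Q 0).
  apply: compact_operator_continuous; apply: (adm_D_compact adm).
  by rewrite linear0; exact: adm_V0 adm.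
have Lc y : `|y| < r -> {for y, continuous L}.
  apply: ball_continuous => z u zr; first exact/adm_derivable/rV.
  exact/adm_derive_continuous/rV.
pose Phi (p : H * H) := L p.1 + 'D_(p.2) L p.1 + c / 2 * `|p.2| ^+ 2
  - K / 2 * `|Q 0 p.2| ^+ 2 - L (p.1 + p.2).
have cPhi : {for (x, h), continuous Phi}.
  have c1 : p.1 @[p --> (x, h)] --> x by exact: cvg_fst.
  have c2 : p.2 @[p --> (x, h)] --> h by exact: cvg_snd.
  have c12 : p.1 + p.2 @[p --> (x, h)] --> x + h by exact: cvgD.
  have cL : L p.1 @[p --> (x, h)] --> L x by exact: (cvg_comp _ _ c1 (Lc _ xr)).
  have cL12 : L (p.1 + p.2) @[p --> (x, h)] --> L (x + h).
    exact: (cvg_comp _ _ c12 (Lc _ xhr)).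
  have cD : 'D_(p.2) L p.1 @[p --> (x, h)] --> 'D_h L x.
    exact: (@adm_derive_continuous x h (rV _ xr)).
  have cn : `|p.2| @[p --> (x, h)] --> `|h| by exact: cvg_norm.
  have cQ : `|Q 0 p.2| @[p --> (x, h)] --> `|Q 0 h|.
    by apply: cvg_norm; exact: (cvg_comp _ _ c2 (Q0c _)).
  apply: cvgB cL12; apply: cvgB; last by apply: cvgMl_tmp; apply: cvgM.
  by apply: cvgD; [apply: cvgD|apply: cvgMl_tmp; apply: cvgM].
have Phi0 : 0 < Phi (x, h) by rewrite subr_gt0.
have : \forall p \near (x, h), [/\ 0 < Phi p, `|p.1| < r & `|p.1 + p.2| < r].
  near=> p; split; near: p; first exact: cvgr_gt cPhi _ Phi0.
    by apply: cvgr_norm_lt xr; exact: cvg_fst.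
  by apply: cvgr_norm_lt xhr; apply: cvgD; [exact: cvg_fst|exact: cvg_snd].
move=> [[P1 P2] [/= P1x P2h] PP].
have dense_nbhs (y : H) (D : set H) : nbhs y D -> exists y', D (j y').
  rewrite nbhsE => -[N [No Ny] ND].
  have [z [Nz [y' _ y'E]]] := adm_j_dense adm (ex_intro _ y Ny) No.
  by exists y'; apply: ND; rewrite y'E.
have [x' Px'] := dense_nbhs _ _ P1x; have [h' Ph'] := dense_nbhs _ _ P2h.
have [|/= Phi0' xr' xhr'] := PP (j x', j h') _; first by split.
have := taylor_lower_bound_on_X hess rV rd xr' xhr'.
by move: Phi0'; rewrite /Phi /= subr_gt0 => /lt_le_trans/[apply]; rewrite ltxx.
Unshelve. all: by end_near. Qed.

Lemma descending_path (U : set H) :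
  isolated [set x | V x /\ critical_point L x] 0 -> nbhs 0 U ->
  ~ (\forall x \near 0, L 0 <= L x) ->
  exists y, y != 0 /\ joined ([set x | L x <= L 0] `&` U) 0 y.
Proof.
move=> [_ [D D0 Dcrit]] U0 nmin.
have [c [K [d [c0 K0 d0 hess]]]] := hessian_lower_bound.
have V0 : nbhs 0 V.
  by apply: open_nbhs_nbhs; split; [exact: adm_V_open adm|exact: adm_V0 adm].
have /nbhs_ballP[e /= e0 eP] : nbhs 0 (D `&` (U `&` V)).
  exact: filterI D0 (filterI U0 V0).
pose r := Num.min e d.
have r0 : 0 < r by rewrite lt_min e0.
have rP x : `|x| < r -> D x /\ U x /\ V x.
  move=> xr; apply: eP; rewrite -ball_normE /= sub0r normrN.
  by rewrite (lt_le_trans xr)// ge_min lexx.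
have rV x : `|x| < r -> V x by move=> /rP[_ []].
have Q0 : compact_operator (Q 0).
  by apply: (adm_D_compact adm); rewrite linear0; exact: adm_V0 adm.
have [||||||y [y0 jy]] := @joined_origin R H L (Q 0) r (c / 2) (K / 2)
  _ _ Q0 _ _ _ _ r0 nmin.
- by rewrite divr_gt0.
- by rewrite divr_ge0.
- by move=> x u /rV; exact: adm_derivable.
- by move=> x u /rV; exact: adm_derive_continuous.
- apply: taylor_lower_bound hess rV _; rewrite ge_min lexx orbT//.
- move=> x xr Dx; have [Dx' [_ Vx]] := rP x xr.
  suff : (D `&` [set x | V x /\ critical_point L x]) x by rewrite Dcrit.
  by split=> //; split=> // u; split; [exact: adm_derivable|exact: Dx].
exists y; split=> //; apply: joined_subset jy => x [Lx xr].
by split=> //; have [_ []] := rP x xr.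
Qed.

End Admissible.

(** * Singular homology of pairs *)

Lemma simplex_inhabited (R : realType) (n : nat) : exists t, std_simplex R n t.
Proof.
exists (\row_i (i == ord0)%:R); split=> [i|].
  by rewrite mxE ler0n.
rewrite (bigD1 ord0) //= mxE eqxx big1 ?addr0// => i /negbTE i0.
by rewrite mxE i0.
Qed.

Section SingularChainFacts.
Variables (R : realType) (T : topologicalType) (K : zmodType).
Implicit Types (S Z : set T).

Definition const_simplex (n : nat) (x : T) : singular_simplex R T n :=
  cst x.

Lemma face_const n i x : face i (const_simplex n.+1 x) = const_simplex n x.
Proof. exact/continuousEP. Qed.

Lemma chain_inN n S (c : chain R T K n) : chain_in S c -> chain_in S (- c).
Proof.
by move=> cS; rewrite -sub0r; apply: chain_inB => //; exact: chain_in0.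
Qed.

Lemma chain_inD n S (c d : chain R T K n) :
  chain_in S c -> chain_in S d -> chain_in S (c + d).
Proof.
by move=> cS dS; rewrite -[d]opprK; apply: chain_inB => //; exact: chain_inN.
Qed.

Lemma chain_in_mulz n S (c : chain R T K n) (m : int) :
  chain_in S c -> chain_in S (c *~ m).
Proof.
move=> cS; have cm k : chain_in S (c *+ k).
  elim: k => [|k IH]; first by rewrite mulr0n; exact: chain_in0.
  by rewrite mulrS; exact: chain_inD.
case: m => k; first exact: cm.
by rewrite NegzE mulrNz; apply: chain_inN; exact: cm.
Qed.

Lemma chain_in_sum n S (I : eqType) (r : seq I) (F : I -> chain R T K n) :
  (forall i, i \in r -> chain_in S (F i)) -> chain_in S (\sum_(i <- r) F i).
Proof.
move=> FS; rewrite big_seq; elim/big_ind: _ => //; first exact: chain_in0.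
exact: chain_inD.
Qed.

Lemma chain_inU n S (s : singular_simplex R T n) (a : K) :
  range (s : _ -> T) `<=` S -> chain_in S (mkmalgU s a : chain R T K n).
Proof. by move=> sS s' /(fsubsetP msuppU_le); rewrite in_fset1 => /eqP->. Qed.

Lemma boundaryD n (c d : chain R T K n) :
  boundary (c + d) = boundary c + boundary d.
Proof. exact: raddfD. Qed.

Lemma chain_in_boundary n Z (c : chain R T K n) :
  chain_in Z c -> chain_in Z (boundary c).
Proof.
case: n c => [|n] c cZ; first exact: chain_in0.
apply: chain_in_sum => s sc; apply: chain_in_sum => i _.
apply: chain_in_mulz; apply: chain_inU => _ [t _ <-].
by apply: (cZ s sc); exists (coface i t).
Qed.

Lemma boundaryU n (s : singular_simplex R T n.+1) (a : K) :
  boundary (mkmalgU s a : chain R T K n.+1) =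
  \sum_(i < n.+2) (mkmalgU (face i s) a : chain R T K n) *~ (-1) ^+ i.
Proof.
rewrite /boundary /boundary_succ.
have [->|a0] := eqVneq a 0.
  rewrite monalgU0 msupp0 big_nil big1 => // i _.
  by rewrite monalgU0 mul0rz.
by rewrite msuppU (negbTE a0) big_seq_fset1 mcoeffUU.
Qed.

Lemma boundary_const n x (a : K) :
  boundary (mkmalgU (const_simplex n.+1 x) a : chain R T K n.+1) =
  if odd n then (mkmalgU (const_simplex n x) a : chain R T K n) else 0.
Proof.
rewrite boundaryU; under eq_bigr do rewrite face_const.
rewrite -mulrz_sumr.
have -> : \sum_(i < n.+2) (-1) ^+ i = (odd n)%:Z.
  elim: n => [|n IH]; first by rewrite !big_ord_recr big_ord0.
  by rewrite big_ord_recr /= IH exprS -signr_odd /=; case: (odd n).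
by case: (odd n).
Qed.

(** Modulo chains avoiding [x], a chain of [S] is thus determined by its coefficient at the constant
    simplex. *)
Lemma chain_split n S x (c : chain R T K n) :
  (forall s : singular_simplex R T n, range (s : _ -> T) `<=` S ->
    s = const_simplex n x \/ range (s : _ -> T) `<=` S `\ x) ->
  chain_in S c ->
  chain_in (S `\ x)
    (c - mkmalgU (const_simplex n x) (mcoeff (const_simplex n x) c)).
Proof.
move=> dich cS s; rewrite -mcoeff_neq0 mcoeffB mcoeffU.
have [<-|ns] := eqVneq (const_simplex n x) s; first by rewrite mulr1n subrr eqxx.
rewrite mulr0n subr0 mcoeff_neq0 => sc.
by have [sx|] := dich s (cS s sc); first by rewrite sx eqxx in ns.
Qed.

Lemma mcoeff_chain_in n S x (c : chain R T K n) : chain_in (S `\ x) c ->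
  mcoeff (const_simplex n x) c = 0.
Proof.
move=> cS; apply: mcoeff_outdom; apply/negP => /cS cx.
have [t /mem_set tn] := simplex_inhabited R n.
have [|_] := cx x; last exact.
by exists (exist _ t tn).
Qed.

End SingularChainFacts.

Lemma isomorphic_inv (G G' : zmodType) (f : {additive G -> G'}) :
  injective f -> (forall y, exists x, f x = y) -> isomorphic G' G.
Proof.
move=> f_inj /choice[g fg].
have gB : zmod_morphism g by move=> x y; apply: f_inj; rewrite raddfB !fg.
pose ga : {additive G' -> G} := HB.pack g (GRing.isZmodMorphism.Build _ _ g gB).
exists ga; exists f => [y|x]; first exact: fg.
by apply: f_inj; exact: fg.
Qed.

Lemma isomorphic_trivial (G : zmodType) :
  (forall g : G, g = 0) -> isomorphic G trivial_group.
Proof.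
move=> G0; pose f (_ : G) : trivial_group := 0.
have fB : zmod_morphism f by move=> x y; rewrite subr0.
pose fa : {additive G -> trivial_group} :=
  HB.pack f (GRing.isZmodMorphism.Build _ _ f fB).
exists fa; exists (fun=> 0) => [g|v]; first by rewrite (G0 g).
by rewrite [v]thinmx0 [fa _]thinmx0.
Qed.

Lemma isomorphic_nontrivial (G G' : zmodType) :
  isomorphic G G' -> nontrivial G' -> nontrivial G.
Proof.
move=> [f [g fg gf]] [y y0]; exists (g y); apply: contra_neq y0 => gy0.
by rewrite -[y]gf gy0 raddf0.
Qed.

Section RelativeHomologyFacts.
Local Open Scope quotient_scope.
Variables (R : realType) (T : topologicalType) (K : zmodType).

Lemma rel_class_eq0 (Y Z : set T) n (c : rel_cycles R K Y Z n) :
  (\pi_(rel_homology R K Y Z n) c == 0) = (c \in @rel_boundary R T K Y Z n).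
Proof. by rewrite piE Quotient.equivE subr0. Qed.

Lemma rel_homology_eq0 (Y Z : set T) n :
  (forall c : chain R T K n, chain_in Y c -> chain_in Z (boundary c) ->
    exists (d : chain R T K n.+1) (e : chain R T K n),
      [/\ chain_in Y d, chain_in Z e & c = boundary d + e]) ->
  forall q : rel_homology R K Y Z n, q = 0.
Proof.
move=> bd q; rewrite -[q]reprK; apply/eqP; rewrite rel_class_eq0.
by apply/asboolP; have /asboolP[] := cycle_valP (repr q); exact: bd.
Qed.

Variables (S : set T) (x : T).
Hypothesis Sx : S x.

Lemma chain_in_const n (a : K) :
  chain_in S (mkmalgU (const_simplex R n x) a : chain R T K n).
Proof. by apply: chain_inU => _ [t _ <-]. Qed.

Hypothesis dichotomy : forall n (s : singular_simplex R T n),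
  range (s : _ -> T) `<=` S ->
  s = const_simplex R n x \/ range (s : _ -> T) `<=` S `\ x.

(** As for a point: for [n] even the constant simplex of degree [n + 1] is a boundary; for [n] odd
    its boundary is the constant [n]-simplex, so a relative cycle has coefficient [0] there. *)
Lemma isolated_homology_succ n :
  forall q : rel_homology R K S (S `\ x) n.+1, q = 0.
Proof.
apply: rel_homology_eq0 => c cS bcS.
set a := mcoeff (const_simplex R n.+1 x) c.
pose c0 : chain R T K n.+1 := mkmalgU (const_simplex R n.+1 x) a.
have c1S : chain_in (S `\ x) (c - c0).
  by apply: chain_split => // s; exact: dichotomy.
case: (boolP (odd n)) => on; last first.
  exists (mkmalgU (const_simplex R n.+2 x) a), (c - c0); split => //.
    exact: chain_in_const.
  by rewrite boundary_const /= on addrC subrK.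
exists 0, c; split; [exact: chain_in0| |by rewrite raddf0 add0r].
suff a0 : a = 0 by move: c1S; rewrite /c0 a0 monalgU0 subr0.
have : chain_in (S `\ x) (boundary c0).
  have -> : c0 = c - (c - c0) by rewrite opprB addrC subrK.
  rewrite boundary_is_additive.
  exact: (chain_inB bcS (chain_in_boundary c1S)).
by rewrite boundary_const on => /mcoeff_chain_in; rewrite mcoeffUU.
Qed.

Lemma const_rel_cycle (a : K) :
  (mkmalgU (const_simplex R 0 x) a : chain R T K 0) \in
    rel_cycle S (S `\ x) (n := 0).
Proof.
by apply/asboolP; split; [exact: chain_in_const|exact: chain_in0].
Qed.

Definition const_class (a : K) : rel_homology R K S (S `\ x) 0 :=
  \pi_(rel_homology R K S (S `\ x) 0) (RelCycle (const_rel_cycle a)).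

Lemma const_class_is_zmod_morphism : zmod_morphism const_class.
Proof.
move=> a b; rewrite /const_class -raddfB; congr (\pi_ _ _).
by apply: val_inj; rewrite /= monalgUB.
Qed.

HB.instance Definition _ := GRing.isZmodMorphism.Build _ _ const_class
  const_class_is_zmod_morphism.

(** The inverse is [const_class]. It is injective because the boundary of a 1-chain has coefficient
    [0] at [x]: the constant 1-simplex has zero boundary and the rest avoids [x]. It is surjective
    by [chain_split]. *)
Lemma isolated_homology0 : isomorphic (rel_homology R K S (S `\ x) 0) K.
Proof.
apply: (@isomorphic_inv _ _ const_class) => [|q].
  apply: raddf_inj => a /eqP; rewrite rel_class_eq0 => /asboolP[d [e [dS eS E]]].
  have {}E : mkmalgU (const_simplex R 0 x) a = boundary d + e := E.
  have := congr1 (mcoeff (const_simplex R 0 x)) E.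
  rewrite mcoeffUU mcoeffD (mcoeff_chain_in eS) addr0 => ->.
  pose d0 : chain R T K 1 :=
    mkmalgU (const_simplex R 1 x) (mcoeff (const_simplex R 1 x) d).
  rewrite -[d](subrK d0) boundaryD mcoeffD boundary_const /= mcoeff0 addr0.
  apply: (@mcoeff_chain_in _ _ _ 0 S); apply: (@chain_in_boundary _ _ _ 1).
  by apply: chain_split => // s; exact: dichotomy.
have /asboolP[qS _] := cycle_valP (repr q).
exists (mcoeff (const_simplex R 0 x) (cycle_val (repr q))).
rewrite -[RHS]reprK; apply/eqP.
rewrite -subr_eq0 /= /const_class -raddfB rel_class_eq0; apply/asboolP.
set a := mcoeff _ _; set c := cycle_val (repr q).
exists 0, (mkmalgU (const_simplex R 0 x) a - c); split.
- exact: chain_in0.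
- rewrite -opprB; apply: chain_inN.
  by apply: chain_split => // s; exact: dichotomy.
- by rewrite raddf0 add0r.
Qed.

End RelativeHomologyFacts.

(** * Simplices near an isolated point, and the effect of a path on degree zero *)

Lemma simplex_segment (R : realType) (n : nat) (t0 t1 : std_simplex R n) :
  exists p : R -> std_simplex R n, [/\ continuous p, p 0 = t0 & p 1 = t1].
Proof.
pose q (a : R) : 'rV[R]_n.+1 :=
  set_val t0 + Num.min 1 (Num.max 0 a) *: (set_val t1 - set_val t0).
have qP a : q a \in std_simplex R n.
  have [t00 t01] : std_simplex R n (set_val t0) := set_valP t0.
  have [t10 t11] : std_simplex R n (set_val t1) := set_valP t1.
  rewrite /q; set b := Num.min _ _.
  have b0 : 0 <= b by rewrite le_min ler01 le_max lexx.
  have b1 : b <= 1 by rewrite ge_min lexx.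
  apply/mem_set; split=> [i|].
    by rewrite !mxE; have := t00 i; have := t10 i; nra.
  under eq_bigr do rewrite !mxE.
  by rewrite big_split -mulr_sumr /= sumrB t01 t11 subrr mulr0 addr0.
exists (fun a => exist _ (q a) (qP a)); split.
- apply: continuous_comp_initial => a.
  apply: cvgD; first exact: cvg_cst.
  apply: cvgZr_tmp.
  apply: continuous_min; first exact: cvg_cst.
  by apply: continuous_max; [exact: cvg_cst|exact: cvg_id].
- apply: val_inj => /=; rewrite /q (max_idPl (lexx 0)) (min_idPr ler01).
  by rewrite scale0r addr0.
- apply: val_inj => /=; rewrite /q (max_idPr ler01) (min_idPl (lexx 1)).
  by rewrite scale1r addrC subrK.
Qed.

Section CriticalGroups.
Variables (R : realType) (H : normedModType R) (K : zmodType).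
Variables (S : set H) (x : H).

(** The set of times spent at [x] is open by isolation and closed because points are closed; the
    line is connected. *)
Lemma path_to_isolated_point (D : set H) (g : R -> H) : nbhs x D ->
  (forall y, D y -> S y -> y = x) -> continuous g -> (forall a, S (g a)) ->
  g 0 = x -> g 1 = x.
Proof.
move=> xD Dx cg gS g0.
have R_connected : connected [set: R] by apply/connected_intervalP.
suff E : [set a | g a = x] = [set: R] by have : [set: R] 1 by []; rewrite -E.
apply: R_connected; first by exists 0.
  exists [set a | g a = x]; last by rewrite setTI.
  rewrite openE => a /= ga; have : \forall b \near a, D (g b).
    by apply: cg; rewrite ga.
  by apply: filterS => b Db; exact: Dx.
exists [set a | g a = x]; last by rewrite setTI.
have -> : [set a | g a = x] = g @^-1` [set x] by [].
apply: preimage_closed => //; apply: accessible_closed_set1.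
exact/hausdorff_accessible/norm_hausdorff.
Qed.

Lemma isolated_dichotomy (D : set H) n (s : singular_simplex R H n) :
  nbhs x D -> (forall y, D y -> S y -> y = x) -> range (s : _ -> H) `<=` S ->
  s = const_simplex R n x \/ range (s : _ -> H) `<=` S `\ x.
Proof.
move=> xD Dx sS.
have [[t0 st0]|ns] := pselect (exists t, s t = x); last first.
  by right=> _ [t _ <-]; split=> [|st]; [apply: sS; exists t|apply: ns; exists t].
left; apply/continuousEP => t1 /=.
have [p [cp p0 p1]] := simplex_segment t0 t1.
rewrite -[in LHS]p1; apply: (@path_to_isolated_point D (s \o p)) => //.
- by move=> a; apply: continuous_comp; [exact: cp|exact: cts_fun].
- by move=> a; apply: sS; exists (p a).
- by rewrite /= p0.
Qed.

Lemma simplex0_dichotomy (s : singular_simplex R H 0) (y : H) :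
  range (s : _ -> H) `<=` S ->
  s = const_simplex R 0 y \/ range (s : _ -> H) `<=` S `\ y.
Proof.
move=> sS.
have one_pt (t t' : std_simplex R 0) : t = t'.
  apply: val_inj; apply/rowP => i; rewrite (ord1 i).
  have [_] : std_simplex R 0 (set_val t) := set_valP t.
  have [_] : std_simplex R 0 (set_val t') := set_valP t'.
  by rewrite !big_ord1 => -> ->.
have [[t0 st0]|ns] := pselect (exists t, s t = y); last first.
  by right=> _ [t _ <-]; split=> [|st]; [apply: sS; exists t|apply: ns; exists t].
by left; apply/continuousEP => t; rewrite (one_pt t t0).
Qed.

(** The path is a singular 1-simplex with boundary [y - x], so the part of a 0-chain carried by [x]
    can be moved to [y], that is into [S] minus [x]. *)
Lemma joined_homology0 (y : H) : joined S x y -> y != x ->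
  forall q : rel_homology R K S (S `\ x) 0, q = 0.
Proof.
move=> jxy yx; have [_ Sy] := joined_mem jxy.
have [p [cp p0 p1 pS]] := jxy.
have cs : continuous (fun t : std_simplex R 1 => p ((set_val t : 'rV[R]_2) 0 1)).
  move=> t; apply: (@continuous_comp _ _ _
    (fun t : std_simplex R 1 => (set_val t : 'rV[R]_2) 0 1) p); last exact: cp.
  apply: (@continuous_comp _ _ _ set_val (fun v : 'rV[R]_2 => v 0 1)).
    exact: initial_continuous.
  exact: coord_continuous.
pose s : singular_simplex R H 1 := mkcts cs.
apply: rel_homology_eq0 => c cS _.
set a := mcoeff (const_simplex R 0 x) c.
have c1S := chain_split (fun s => @simplex0_dichotomy s x) cS.
have bs : boundary (mkmalgU s a : chain R H K 1) =
    mkmalgU (const_simplex R 0 y) a - mkmalgU (const_simplex R 0 x) a.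
  (* The parameter is the barycentric coordinate of index [1]: omitting vertex [0] leaves the end
     [y], omitting vertex [1] the start [0]-end [x]. *)
  have -> : const_simplex R 0 y = face ord0 s.
    apply/continuousEP => t; rewrite /= /s /mkcts /= mxE.
    have [_] : std_simplex R 0 (set_val t) := set_valP t.
    rewrite big_ord1; have -> : 1 = lift ord0 ord0 :> 'I_2 by exact: val_inj.
    by rewrite liftK /= => ->; rewrite p1.
  have -> : const_simplex R 0 x = face (lift ord0 ord0) s.
    apply/continuousEP => t; rewrite /= /s /mkcts /= mxE.
    have -> : 1 = lift ord0 ord0 :> 'I_2 by exact: val_inj.
    by rewrite unlift_none /= p0.
  by rewrite boundaryU !big_ord_recl big_ord0 addr0 expr0 expr1 mulr1z mulrNz mulr1z.
exists (- (mkmalgU s a : chain R H K 1)),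
  (c - mkmalgU (const_simplex R 0 x) a + mkmalgU (const_simplex R 0 y) a); split.
- apply: chain_inN; apply: chain_inU => _ [t _ <-]; exact: pS.
- apply: chain_inD => //; apply: chain_inU => _ [t _ <-]; split=> //.
  exact/eqP.
- have -> : boundary (- (mkmalgU s a : chain R H K 1)) =
      - boundary (mkmalgU s a : chain R H K 1) by exact: raddfN.
  by rewrite bs opprB [c - _ + _]addrC addrA subrK addrC subrK.
Qed.

End CriticalGroups.

Lemma local_min_derive0 (R : realType) (H : normedModType R) (f : H -> R)
    (x u : H) : (forall v, derivable f x v) ->
  (\forall y \near x, f x <= f y) -> 'D_u f x = 0.
Proof.
move=> df xmin.
have D0 v : 0 <= 'D_v f x.
  rewrite -oppr0; apply: derive_lower_bound => //.
  have : \forall t \near (0 : R)^'+, f x <= f (x + t *: v).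
    exact: (@near_ray _ _ x v (fun y => f x <= f y)).
  by apply: filterS => t; rewrite mul0r subr0.
apply/eqP; rewrite eq_le D0 andbT.
by have := D0 (- u); rewrite -scaleN1r derive_scale_dir// mulN1r oppr_ge0.
Qed.

Theorem corollary2p7 (R : realType) (H : completeNormedModType R)
    (ip : {dot H for idfun}) (X : completeNormedModType R)
    (j : {linear X -> H}) (V : set H) (L : H -> R) (A : X -> X)
    (B P Q : X -> {linear H -> H})
    (adm : admissible ip j V L A B P Q)
    (isol : isolated [set x | V x /\ critical_point L x] 0)
    (K : zmodType) (K_neq0 : nontrivial K)
    (U : set H) (U_nbhs : nbhs 0 U) (U_sub : U `<=` V) :
  ((\forall x \near 0, L 0 <= L x) <->
   (forall q : int, isomorphic (critical_group K L U 0 q) (delta_group q K))) /\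
  ((forall q : int, isomorphic (critical_group K L U 0 q) (delta_group q K)) <->
   nontrivial (critical_group K L U 0 0)).
Proof.
pose S := [set y | L y <= L 0] `&` U.
have S0 : S 0 by split=> //=; exact: nbhs_singleton.
have min_iso : (\forall x \near 0, L 0 <= L x) ->
    forall q, isomorphic (critical_group K L U 0 q) (delta_group q K).
  move=> Lmin; have [_ [D D0 Dcrit]] := isol.
  (* A point of [S] near which [L >= L 0] is itself a local minimum of [L], hence critical, hence
     [0]. *)
  have S_isolated y : ((fun y => \forall z \near y, L 0 <= L z) `&` D) y ->
      S y -> y = 0.
    move=> [ymin Dy] [Ly Uy]; have Vy := U_sub _ Uy.
    suff : (D `&` [set x | V x /\ critical_point L x]) y by rewrite Dcrit.
    split=> //; split=> // u; split; first exact: (adm_derivable adm).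
    apply: local_min_derive0 => [v|]; first exact: (adm_derivable adm).
    by apply: filterS ymin => z; exact: le_trans.
  have D'0 : nbhs 0 ((fun y => \forall z \near y, L 0 <= L z) `&` D).
    by apply: filterI => //; exact/nbhs_interior.
  have dich n (s : singular_simplex R H n) :=
    @isolated_dichotomy R H S 0 _ n s D'0 S_isolated.
  case=> [[|n]|n].
  - exact: isolated_homology0 S0 dich.
  - exact/isomorphic_trivial/(isolated_homology_succ S0 dich).
  - by apply: isomorphic_trivial => v; exact: thinmx0.
(* [K_neq0] enters here: for [K = 0] all the groups vanish, so (ii) would hold and (iii) fail. *)
have iso_nontrivial :
    (forall q, isomorphic (critical_group K L U 0 q) (delta_group q K)) ->
    nontrivial (critical_group K L U 0 0).
  by move=> /(_ 0)/isomorphic_nontrivial; apply.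
have nontrivial_min : nontrivial (critical_group K L U 0 0) ->
    \forall x \near 0, L 0 <= L x.
  move=> [g g0]; apply: contrapT => nmin.
  have [y [y0 jy]] := descending_path adm isol U_nbhs nmin.
  by move: g0; rewrite (joined_homology0 jy y0 g) eqxx.
split; split=> //; first by move=> /iso_nontrivial/nontrivial_min.
by move=> /nontrivial_min/min_iso.
Qed.
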